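(* Let $n\ge1$, $s\in(0,1)$, and let $\Omega\subset\mathbb{R}^n$ be a bounded $C^{1,1}$ domain. There is a constant $c_0>0$ depending only on $n,s,\Omega$ such that the following holds. Let $a\in C^0(\mathbb{R}^n)$ be such that either $\min_{\overline{\Omega}}a>0$ or $\|a\|_{C^0(\Omega)}\le c_0$. Then for any $\varepsilon>0$ there exists $b\in C^0(\mathbb{R}^n)$ with $\|b\|_{C^0}<\varepsilon$ such that all the eigenvalues of the problem $$(-\Delta)^{s}\varphi+\left(a(x)+b(x)\right)\varphi=\lambda\varphi\ \text{ in }\Omega,\qquad \varphi=0\ \text{ in }\mathbb{R}^n\setminus\Omega$$ are simple.
   Context: $C^0$ norms are sup norms: $\|b\|_{C^0}=\sup_{\mathbb{R}^n}|b|$, $\|a\|_{C^0(\Omega)}=\sup_\Omega|a|$. Let $\mathcal{H}^s_0(\Omega)=\{u\in H^s(\mathbb{R}^n): u\equiv 0 \text{ on } \mathbb{R}^n\setminus\Omega\}$, where $H^s(\mathbb{R}^n)=\{u\in L^2(\mathbb{R}^n): \frac{u(x)-u(y)}{|x-y|^{n/2+s}}\in L^2(\mathbb{R}^n\times\mathbb{R}^n)\}$, and let $$\mathcal{E}_s(u,v)=\frac{C_{n,s}}{2}\int_{\mathbb{R}^n}\int_{\mathbb{R}^n}\frac{(u(x)-u(y))(v(x)-v(y))}{|x-y|^{n+2s}}\,dx\,dy,\qquad C_{n,s}=s4^s\frac{\Gamma(s+n/2)}{\pi^{n/2}\Gamma(1-s)}.$$ Eigenvalues are meant in the weak sense: $\lambda\in\mathbb{R}$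 is an eigenvalue of $(-\Delta)^s\varphi+c(x)\varphi=\lambda\varphi$ in $\Omega$, $\varphi=0$ in $\mathbb{R}^n\setminus\Omega$, if there is $\varphi\in\mathcal{H}^s_0(\Omega)\setminus\{0\}$ (an eigenfunction) with $\mathcal{E}_s(\varphi,v)+\int_\Omega c\,\varphi v\,dx=\lambda\int_{\Omega}\varphi v\,dx$ for all $v\in\mathcal{H}^s_0(\Omega)$. It is simple if the space of its eigenfunctions (together with $0$) is one-dimensional. *)

(* Defs.v *)
From HB Require Import structures.
From mathcomp Require Import all_boot all_order all_algebra.
From mathcomp Require Import all_classical all_reals all_analysis.

Set Implicit Arguments.
Unset Strict Implicit.
Unset Printing Implicit Defensive.

Import Order.TTheory GRing.Theory Num.Theory.
Import numFieldNormedType.Exports.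

Local Open Scope classical_set_scope.
Local Open Scope ring_scope.

(** R^n is ['rV[R]_n], with the topology of the library. Its sigma-algebra is
    the one generated by the coordinates (the Borel sets); every
    Lebesgue-measurable function agrees a.e. with a measurable function for it,
    so nothing is lost when functions are considered up to a.e. equality. *)
Definition rV_display : measure_display. Proof. by constructor. Qed.

Section measurable_rV.
Context (R : realType) (n : nat).

Definition rV_coord (i : 'I_n) (x : 'rV[R]_n) : measurableTypeR R := x ord0 i.

Let rV_set0 : g_sigma_preimage rV_coord set0.
Proof. exact: sigma_algebra0. Qed.

Let rV_setC A : g_sigma_preimage rV_coord A -> g_sigma_preimage rV_coord (~` A).
Proof. exact: sigma_algebraC. Qed.

Let rV_bigcup (F : _^nat) : (forall i, g_sigma_preimage rV_coord (F i)) ->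
  g_sigma_preimage rV_coord (\bigcup_i (F i)).
Proof. exact: sigma_algebra_bigcup. Qed.

HB.instance Definition _ := @isMeasurable.Build rV_display
  'rV[R]_n (g_sigma_preimage rV_coord) rV_set0 rV_setC rV_bigcup.

Lemma measurable_rV_coord (i : 'I_n) : measurable_fun setT (rV_coord i).
Proof.
move=> _ Y mY; rewrite setTI; apply: sub_sigma_algebra => /=.
rewrite -bigcup_seq/=; exists i => /=; first by rewrite mem_index_enum.
by exists Y => //; rewrite setTI.
Qed.

Lemma measurable_fun_rV d (T : measurableType d) (f : T -> 'rV[R]_n) :
  (forall i, measurable_fun setT (rV_coord i \o f)) -> measurable_fun setT f.
Proof.
move=> mf _ A; rewrite setTI /measurable/= => mA.
have : preimage_set_system setT f (g_sigma_preimage rV_coord) (f @^-1` A).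
  by exists A => //; rewrite setTI.
rewrite -g_sigma_preimage_comp; apply: smallest_sub.
  exact: sigma_algebra_measurable.
rewrite -bigcup_seq => B [i _] [C mC <-]; exact: mf.
Qed.

End measurable_rV.

Section lebesgue_rV_step.
Context (R : realType) (n : nat).

Definition rV_cons (p : measurableTypeR R * 'rV[R]_n) : 'rV[R]_n.+1 :=
  row_mx (p.1 : R)%:M p.2.

Definition rV_uncons (x : 'rV[R]_n.+1) : measurableTypeR R * 'rV[R]_n :=
  (x ord0 ord0, \row_i x ord0 (lift ord0 i)).

Lemma rV_cons_head p : rV_cons p ord0 ord0 = p.1.
Proof.
have := @row_mxEl _ 1 1 n (p.1 : R)%:M p.2 ord0 ord0.
rewrite [X in _ = X]mxE mulr1n => <-.
by congr (row_mx _ _ _ _); exact: val_inj.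
Qed.

Lemma rV_cons_tail p i : rV_cons p ord0 (lift ord0 i) = p.2 ord0 i.
Proof.
rewrite -(@row_mxEr _ 1 1 n (p.1 : R)%:M p.2).
by congr (row_mx _ _ _ _); exact: val_inj.
Qed.

Lemma rV_consK : cancel rV_cons rV_uncons.
Proof.
move=> [t x]; rewrite /rV_uncons rV_cons_head; congr (_, _).
by apply/rowP => i; rewrite mxE rV_cons_tail.
Qed.

Lemma measurable_rV_cons : measurable_fun setT rV_cons.
Proof.
apply: measurable_fun_rV => i.
have [j ->|->] := unliftP ord0 i.
- rewrite (_ : _ \o _ = rV_coord j \o snd); last first.
    by apply/funext => p; rewrite /= /rV_coord rV_cons_tail.
  by apply: measurableT_comp => //; exact: measurable_rV_coord.
- rewrite (_ : _ \o _ = fst) //; apply/funext => p /=.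
  by rewrite /rV_coord rV_cons_head.
Qed.

Lemma measurable_rV_uncons : measurable_fun setT rV_uncons.
Proof.
apply: measurable_fun_pair; first exact: (@measurable_rV_coord R n.+1 ord0).
apply: measurable_fun_rV => i.
rewrite (_ : _ \o _ = rV_coord (lift ord0 i)); first exact: measurable_rV_coord.
by apply/funext => x; rewrite /rV_coord /= mxE.
Qed.

Variable mu : {sigma_finite_measure set 'rV[R]_n -> \bar R}.

Definition lebesgue_rVS : set 'rV[R]_n.+1 -> \bar R :=
  pushforward (@lebesgue_measure R \x mu)%E rV_cons.

HB.instance Definition _ := Measure.copy lebesgue_rVS
  (measure_function_pushforward__canonical__measure_function_Measure
     (@lebesgue_measure R \x mu)%E measurable_rV_cons).

Let lebesgue_rVS_sigma_finite : sigma_finite setT lebesgue_rVS.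
Proof.
have /sigma_finiteP[F [TF ndF Foo]] := sigma_finiteT (@lebesgue_measure R).
have /sigma_finiteP[G [TG ndG Goo]] := sigma_finiteT mu.
exists (fun k => rV_uncons @^-1` (F k `*` G k)).
  rewrite predeqE => x; split=> // _.
  have : setT (rV_uncons x).1 by [].
  have : setT (rV_uncons x).2 by [].
  rewrite {1}TF {1}TG => -[k _ Gk] [l _ Fl]; exists (maxn k l) => //; split.
    by move: Fl; exact/subsetPset/ndF/leq_maxr.
  by move: Gk; exact/subsetPset/ndG/leq_maxl.
move=> k; have [mF Fk] := Foo k; have [mG Gk] := Goo k; split.
  rewrite -[X in measurable X]setTI; apply: measurable_rV_uncons => //.
  exact: measurableX.
rewrite /lebesgue_rVS /pushforward -comp_preimage.
rewrite (_ : _ \o _ = id); last by apply/funext => p /=; rewrite rV_consK.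
by rewrite preimage_id product_measure1E// lte_mul_pinfty// ge0_fin_numE.
Qed.

HB.instance Definition _ := Measure_isSigmaFinite.Build _ _ _ lebesgue_rVS
  lebesgue_rVS_sigma_finite.

End lebesgue_rV_step.

(** n-dimensional Lebesgue measure: the unit mass on the point R^0, then
    R^(n+1) = R * R^n with the product measure. *)
Fixpoint lebesgue_rV (R : realType) (n : nat) :
    {sigma_finite_measure set 'rV[R]_n -> \bar R} :=
  match n with
  | 0 => \d_(0 : 'rV[R]_0)
  | m.+1 => lebesgue_rVS (lebesgue_rV R m)
  end.

Section defs.
Context {R : realType}.

(* The norm of the library on ['rV[R]_n] is the maximum norm. *)
Definition enorm n (x : 'rV[R]_n) : R := Num.sqrt (\sum_i x ord0 i ^+ 2).

Definition Gamma (z : R) : R :=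
  \int[lebesgue_measure]_(t in `]0, +oo[) (t `^ (z - 1) * expR (- t)).

Definition frac_const (n : nat) (s : R) : R :=
  s * 4 `^ s * Gamma (s + n%:R / 2) / (pi `^ (n%:R / 2) * Gamma (1 - s)).

Section sobolev.
Context {n : nat}.
Local Notation Rn := 'rV[R]_n.
Local Notation mu := (lebesgue_rV R n).

(* Elements of L^2, H^s, etc. are represented by functions; equality, and hence
   vanishing, in these spaces is equality a.e. *)
Definition Hs (s : R) : set (Rn -> R) :=
  [set u | u \in Lfun mu 2%:E /\
    (fun z : Rn * Rn => (u z.1 - u z.2) / enorm (z.1 - z.2) `^ (n%:R / 2 + s))
      \in Lfun (mu \x mu)%E 2%:E].

Definition Hs0 (s : R) (Omega : set Rn) : set (Rn -> R) :=
  [set u | Hs s u /\ u = cst 0 %[ae mu in ~` Omega]].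

Definition Es (s : R) (u v : Rn -> R) : R :=
  frac_const n s / 2 *
  \int[mu]_y (\int[mu]_x ((u x - u y) * (v x - v y) /
                            enorm (x - y) `^ (n%:R + 2 * s))).

(* the weak solutions of (-Delta)^s phi + c phi = lambda phi in Omega, phi = 0
   outside Omega, including 0 *)
Definition eigenspace (s : R) (Omega : set Rn) (c : Rn -> R) (lambda : R) :
    set (Rn -> R) :=
  [set phi | Hs0 s Omega phi /\ forall v, Hs0 s Omega v ->
    Es s phi v + \int[mu]_(x in Omega) (c x * phi x * v x) =
    lambda * \int[mu]_(x in Omega) (phi x * v x)].

Definition eigenfunction s Omega c lambda : set (Rn -> R) :=
  [set phi | eigenspace s Omega c lambda phi /\ ~ (phi = cst 0 %[ae mu])].

Definition is_eigenvalue s Omega c lambda : Prop :=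
  exists phi, eigenfunction s Omega c lambda phi.

Definition is_simple s Omega c lambda : Prop :=
  exists2 phi, eigenfunction s Omega c lambda phi &
    forall psi, eigenspace s Omega c lambda psi ->
      exists t : R, psi = (fun x => t * phi x) %[ae mu].

Definition C0norm (A : set Rn) (f : Rn -> R) : \bar R :=
  ereal_sup [set `|f x|%:E | x in A].

(* m = min_A f *)
Definition is_min (A : set Rn) (f : Rn -> R) (m : R) : Prop :=
  (f @` A) m /\ lbound (f @` A) m.

End sobolev.

Definition C11 n (g : 'rV[R]_n -> R) : Prop :=
  (forall x, differentiable g x) /\
  forall j, lipschitz ('D_(delta_mx ord0 j) g : 'rV[R]_n -> R).

(* In the orthonormal coordinates [y *m Q], Omega lies near x strictly above
   the graph of a C^{1,1} function of the coordinates other than the i-th. *)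
Definition C11_boundary n (Omega : set 'rV[R]_n) : Prop :=
  forall x, (closure Omega `\` interior Omega) x ->
  exists (Q : 'M[R]_n) (i : 'I_n) (g : 'rV[R]_n.-1 -> R),
    [/\ Q *m Q^T = 1%:M, C11 g &
     \forall y \near x, Omega y <-> g (col' i (y *m Q)) < (y *m Q) ord0 i].

Definition bounded_C11_domain n (Omega : set 'rV[R]_n) : Prop :=
  [/\ open Omega, connected Omega, Omega !=set0, bounded_set Omega &
      C11_boundary Omega].

End defs.

(* Main.v *)
Require Import Defs.
From HB Require Import structures.
From mathcomp Require Import all_boot all_order all_algebra.
From mathcomp Require Import all_classical all_reals all_analysis.
From mathcomp Require Import measurable_realfun.
From mathcomp Require Import ring lra.
Set Implicit Arguments.
Unset Strict Implicit.
Unset Printing Implicit Defensive.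
Import Order.TTheory GRing.Theory Num.Theory.
Import numFieldNormedType.Exports.
Local Open Scope classical_set_scope.
Local Open Scope ring_scope.

(** Why potentials with only simple eigenvalues are dense.

    For a potential [c], let the energy of a finite family [w] of functions of
    the form domain be the sum over [u] in [w] of [Es u u + \int_Omega c u^2].
    Among the families that satisfy the Bessel inequality (they encode density
    matrices, that is finite-rank operators between 0 and 1) and have a given
    trace, the infimum of the energy is a concave function of [c], because each
    energy is affine in [c], and the slope of an energy in the direction [h] is
    the integral of [h] against the density [\sum u^2] of the family.  A concave
    function of one variable has few corners; so, by a Baire category argument
    ([generic_pinched]), arbitrarily close to [a] there is a potential [a + b] at
    which, for countably many traces and directions at once, all near-minimisers
    have nearly the same slope.

    Suppose that [a + b] is such a potential and has a double eigenvalue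
    [lambda], with orthonormal eigenfunctions [phi] and [psi].  Minimise the
    energy shifted by [lambda], with no constraint on the trace.  The shifted
    energy does not change when a family is projected onto the orthogonal of
    [phi] and [psi], nor when a vector of their span is then appended to it; so
    near-minimisers of a suitable trace exist whose last member is a multiple of
    an arbitrary unit vector [theta] of the span ([double_eigenvalue_near_min]).
    Equal slopes say that [\int_Omega h theta^2] does not depend on [theta].  As
    the directions [h] determine an integrable function ([tent_separating]),
    [phi^2 = psi^2] and [phi psi = 0] almost everywhere in [Omega], whence
    [phi = 0], a contradiction ([generic_no_double]).  No eigenvalue is ever
    constructed: near-minimisers replace the spectral theorem.

    The one fact of spectral nature is that the traces of low-energy families
    are bounded.  It follows from a quantitative Rellich inequality
    ([inner_compact]): up to a small multiple of [Es u u], the square of the L^2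
    norm of [u] is controlled by finitely many averages of [u] over cubes.  This
    needs [frac_const n s > 0], hence the convergence of the Gamma integral
    ([Gamma_gt0]), and the boundedness of [Omega]. *)

(** * Generic differentiability of an infimum of affine functions *)

Section generic_slopes.
Context (R : realType) (X : topologicalType) (W : Type).
Context (f : W -> R) (pair : W -> (X -> R) -> R).
Context (A : nat -> set W) (h : nat -> X -> R) (tau e : nat -> R).

(** Minimisers need not exist, and are never needed: the derivative of a concave
    infimum is read off from near-minimisers. *)
Definition near_min (k : nat) (b : X -> R) (eta : R) (w : W) : Prop :=
  A k w /\ forall v, A k v -> f w + pair w b <= f v + pair v b + eta.

(** A quantitative form of: the infimum over [A k] has a derivative at [b] in
    the direction [h k], up to an error [e k]. *)
Definition pinched (k : nat) (b : X -> R) : Prop :=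
  exists2 eta, 0 < eta & forall w w', near_min k b eta w ->
    near_min k b eta w' -> pair w (h k) - pair w' (h k) < e k.

Context (h_cont : forall k, continuous (h k)).
Context (h_itv : forall k x, 0 <= h k x <= 1).
Context (e_gt0 : forall k, 0 < e k).
Context (pairD : forall w k (b : X -> R) (t : R), continuous b ->
  A k w -> pair w (fun x => b x + t * h k x) = pair w b + t * pair w (h k)).
Context (pair_lip : forall w k (b b' : X -> R) (r : R), continuous b ->
  continuous b' -> A k w -> (forall x, `|b' x - b x| <= r) ->
  `|pair w b' - pair w b| <= tau k * r).

Let cont_shift (b : X -> R) k (t : R) : continuous b ->
  continuous (fun x => b x + t * h k x).
Proof.
move=> bc x; apply: cvgD; first exact: bc.
by apply: cvgM; [exact: cvg_cst|exact: h_cont].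
Qed.

Let pair_bnd w k : A k w -> `|pair w (h k)| <= tau k.
Proof.
move=> Aw; have c0 : continuous (fun _ : X => 0 : R) by move=> x; exact: cvg_cst.
have := @pair_lip w k (fun=> 0) _ 1 c0 (@cont_shift _ k 1 c0) Aw.
rewrite pairD// mul1r mulr1 [_ + _ - _]addrAC subrr add0r; apply => x.
by rewrite mul1r add0r subr0 ger0_norm; case/andP: (h_itv k x).
Qed.

(** Along a line, slopes of near-minimisers decrease (up to a small error), being
    slopes of affine majorants of a concave function; as they stay
    between [- tau k] and [tau k], they cannot jump by [e k] at many points of
    the line. *)
Lemma pinched_dense k (b : X -> R) (rho : R) : continuous b -> 0 < rho ->
  exists2 t, 0 <= t <= rho & pinched k (fun x => b x + t * h k x).
Proof.
move=> bc rho0; apply: contrapT => H.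
have np t : 0 <= t <= rho -> ~ pinched k (fun x => b x + t * h k x).
  by move=> t0 P; apply: H; exists t.
have [N Nlarge] : exists N : nat, 4 * tau k < N%:R * e k.

  exists (Num.Def.truncn (4 * tau k / e k)).+1.
  by rewrite -ltr_pdivrMr// truncnS_gt.
pose d := rho / N.+1%:R; have d0 : 0 < d by rewrite divr_gt0.
pose t i := i%:R * d.
have tP i : (i <= N.+1)%N -> 0 <= t i <= rho.
  move=> iN; rewrite /t mulr_ge0 ?ler0n ?(ltW d0)//=.
  have -> : rho = N.+1%:R * d by rewrite /d mulrCA divff ?mulr1.
  by rewrite ler_pM2r// ler_nat.
(* small enough for slopes to increase by at most [e k / 2] between two
   consecutive points of the subdivision *)
pose eta := e k * d / 4; have eta0 : 0 < eta by rewrite divr_gt0// mulr_gt0.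
pose b_ i := fun x => b x + t i * h k x.
have jump i : (i <= N.+1)%N -> exists w w', [/\ near_min k (b_ i) eta w,
    near_min k (b_ i) eta w' & e k <= pair w (h k) - pair w' (h k)].
  move=> /tP /np P; apply: contrapT => Q; apply: P; exists eta => // w w' mw mw'.
  by rewrite ltNge; apply/negP => ?; apply: Q; exists w, w'.
have step i w w' : near_min k (b_ i) eta w -> near_min k (b_ i.+1) eta w' ->
    pair w' (h k) <= pair w (h k) + e k / 2.
  move=> [Aw mw] [Aw' mw'].
  have := mw _ Aw'; have := mw' _ Aw; rewrite /b_ !pairD// /t -[i.+1%:R]natr1 mulrDl mul1r.
  rewrite /eta => h1 h2.
  have : d * (pair w' (h k)) <= d * (pair w (h k) + e k / 2) by lra.
  by rewrite ler_pM2l.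
have desc i : (i <= N.+1)%N -> exists2 w, near_min k (b_ i) eta w &
    pair w (h k) <= tau k - i%:R * (e k / 2) - e k.
  elim: i => [_|i IH iN].
    have [w [w' [mw mw' ww']]] := jump 0%N isT; exists w' => //.
    have := pair_bnd mw.1; rewrite ler_norml mul0r subr0 => /andP[_ ?]; lra.
  have [w mw wle] := IH (ltnW iN); have [v [v' [mv mv' vv']]] := jump _ iN.
  exists v' => //; have := step _ _ _ mw mv; rewrite -[i.+1%:R]natr1 => ?; lra.
have [w mw wle] := desc N (leqnSn N).
have := pair_bnd mw.1; rewrite ler_norml => /andP[? ?]; have ? := e_gt0 k; lra.
Qed.

(** A uniformly small change of [b] moves all energies on [A k] by as little, so
    near-minimisers at [b'] are near-minimisers at [b] with a larger error. *)
Lemma pinched_open k (b : X -> R) : continuous b -> pinched k b ->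
  exists2 r, 0 < r & forall b', continuous b' ->
    (forall x, `|b' x - b x| <= r) -> pinched k b'.
Proof.
move=> bc [eta eta0 P].
pose T := `|tau k| + 1; have T0 : 0 < T by rewrite ltr_pwDr.
exists (eta / (4 * T)); first by rewrite divr_gt0// mulr_gt0.
move=> b' b'c bb'; have close w : A k w -> `|pair w b' - pair w b| <= eta / 4.
  move=> Aw; apply: (le_trans (pair_lip bc b'c Aw bb')).
  have -> : eta / 4 = T * (eta / (4 * T)).
    by field; rewrite gt_eqF.
  rewrite ler_pM2r ?divr_gt0// ?mulr_gt0//.
  by rewrite (le_trans (ler_norm _))// lerDl.
exists (eta / 2) => [|w w' mw mw']; first lra.
have trans v : near_min k b' (eta / 2) v -> near_min k b eta v.
  move=> [Av mv]; split => // u Au; have := mv _ Au.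
  have := close _ Av; have := close _ Au; rewrite !ler_norml.
  by move=> /andP[? ?] /andP[? ?]; lra.
by apply: P; exact: trans.
Qed.

(** Baire category: the conditions [pinched k] are open and dense for the sup
    norm.  The nested balls can be written down because each step moves the
    potential along a single direction [h k], upwards, so that the limit is a
    supremum. *)
Theorem generic_pinched (eps : R) : 0 < eps -> exists b : X -> R,
  [/\ continuous b, forall x, `|b x| <= eps & forall k, pinched k b].
Proof.
move=> eps0.
have stepP k (s : (X -> R) * R) : exists tr : R * R,
    continuous s.1 -> 0 < s.2 -> [/\ 0 <= tr.1 <= s.2 / 2, 0 < tr.2 <= s.2 / 2 &
    forall b', continuous b' ->
      (forall x, `|b' x - (s.1 x + tr.1 * h k x)| <= tr.2) -> pinched k b'].
  have [[sc s0]|] := pselect (continuous s.1 /\ 0 < s.2); last first.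
    by move=> H; exists (0, 0) => sc s0; exfalso; apply: H.
  have [t tP pt] := @pinched_dense k s.1 (s.2 / 2) sc ltac:(lra).
  have [r r0 rP] := pinched_open (@cont_shift _ k t sc) pt.
  exists (t, Num.min r (s.2 / 2)) => _ _; split => //=.
    by rewrite lt_min r0 ge_min lexx orbT andbT /= divr_gt0.
  move=> b' b'c bb'; apply: rP => // x; apply: (le_trans (bb' x)).
  by rewrite ge_min lexx.
have [next nextP] := choice (fun ks => stepP ks.1 ks.2).
pose st := fix st k := if k is k'.+1 then
  ((fun x => (st k').1 x + (next (k', st k')).1 * h k' x),
    (next (k', st k')).2) else ((fun=> 0), eps).
have stc k : continuous (st k).1 /\ 0 < (st k).2.
  elim: k => [|k [IHc IH0]] /=; first by split => // x; exact: cvg_cst.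
  have [_ /andP[? _] _] := nextP (k, st k) IHc IH0; split => //.
  exact: cont_shift.
pose b_ k := (st k).1; pose r k := (st k).2.
have stS k : [/\ forall x, b_ k x <= b_ k.+1 x <= b_ k x + r k / 2,
    r k.+1 <= r k / 2 & forall b', continuous b' ->
      (forall x, `|b' x - b_ k.+1 x| <= r k.+1) -> pinched k b'].
  have [IHc IH0] := stc k; have [/andP[t0 tr] /andP[_ ?] ?] := nextP (k, st k) IHc IH0.
  split => // x; rewrite /b_ /= lerDl; case/andP: (h_itv k x) => ? ?.
  by rewrite mulr_ge0//= lerD2l; apply: le_trans tr; rewrite ler_piMr.
have r0 k : 0 < r k by have [] := stc k.
have mono k m x : b_ k x <= b_ (m + k)%N x <= b_ k x + r k - r (m + k)%N.
  elim: m => [|m /andP[IH1 IH2]]; first by rewrite add0n addrK lexx.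
  have [/(_ x)/andP[? ?] ? _] := stS (m + k)%N; rewrite addSn.
  by apply/andP; split; lra.
pose b x := sup (range (fun k => b_ k x)).
have supP k x : b_ k x <= b x <= b_ k x + r k.
  have ub : ubound (range (fun k => b_ k x)) (b_ k x + r k).
    move=> _ [m _ <-]; have [km|mk] := leqP k m.
      rewrite -(subnK km); have /andP[_ ?] := mono k (m - k)%N x.
      by have ? := r0 (m - k + k)%N; lra.
    by have /andP[+ _] := mono m (k - m)%N x; rewrite subnK ?(ltnW mk)//; have := r0 k; lra.
  have ne : range (fun k => b_ k x) !=set0 by exists (b_ k x), k.
  rewrite ub_le_sup//=; [exact: ge_sup|by exists (b_ k x + r k)|by exists k].
have r_small k : r k <= eps / 2 ^+ k.
  elim: k => [|k IH]; first by rewrite expr0 divr1.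
  have [_ ? _] := stS k; rewrite exprSr invfM mulrA => *; lra.
have bc : continuous b.
  move=> x; apply/cvgrPdist_lt => d d0.
  have [k kP] : exists k, r k < d / 2.
    exists (Num.Def.truncn (2 * eps / d)).+1; set N := (_.+1).
    apply: (le_lt_trans (r_small N)); rewrite ltr_pdivrMr ?exprn_gt0//.
    have : 2 * eps / d < N%:R by rewrite truncnS_gt.
    rewrite ltr_pdivrMr// => H.
    have ? : N%:R * d <= 2 ^+ N * d.
      by rewrite ler_pM2r// -natrX ler_nat ltnW// ltn_expl.
    lra.
  have [bkc _] := stc k.
  have /cvgrPdist_lt/(_ (d / 2) ltac:(lra)) := bkc x.
  apply: filterS => y; rewrite -/(b_ k) !ltr_norml => /andP[? ?].
  have /andP[? ?] := supP k x; have /andP[? ?] := supP k y.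
  by apply/andP; split; lra.
exists b; split => //.
  move=> x; have /andP[] := supP 0%N x; rewrite /b_ /r /= add0r => ? ?; rewrite ger0_norm//.
move=> k; have [_ _ H] := stS k; apply: H => // x.
have /andP[? ?] := supP k.+1 x; rewrite -/(b_ k.+1) ger0_norm; lra.
Qed.

End generic_slopes.

(** * Density matrices and double eigenvalues *)

Section forms.
Context (R : realType) (V : lmodType R).

Definition subspace (D : set V) : Prop :=
  D 0 /\ forall a u v, D u -> D v -> D (a *: u + v).

Definition sym_bilinear (D : set V) (B : V -> V -> R) : Prop :=
  (forall u v, D u -> D v -> B u v = B v u) /\
  (forall a u v w, D u -> D v -> D w -> B (a *: u + v) w = a * B u w + B v w).

Lemma subspaceZ D a u : subspace D -> D u -> D (a *: u).
Proof. by move=> [D0 DD] Du; have := DD a u 0 Du D0; rewrite addr0. Qed.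

Context (D : set V) (sD : subspace D).

Section form.
Context (B : V -> V -> R) (hB : sym_bilinear D B).

Lemma formZDr a u v w : D u -> D v -> D w ->
  B w (a *: u + v) = a * B w u + B w v.
Proof.
have [D0 DD] := sD; have [sB lB] := hB => Du Dv Dw.
by rewrite sB ?lB ?[B w _]sB//; exact: DD.
Qed.

Lemma form0l u : D u -> B 0 u = 0.
Proof.
move=> Du; have := hB.2 1 0 0 u sD.1 sD.1 Du.
by rewrite scaler0 addr0 mul1r => H; lra.
Qed.

Lemma formZl a u v : D u -> D v -> B (a *: u) v = a * B u v.
Proof.
by move=> Du Dv; rewrite -[a *: u]addr0 hB.2 ?form0l ?addr0//; exact: sD.1.
Qed.

Lemma formZr a u v : D u -> D v -> B v (a *: u) = a * B v u.
Proof.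
by move=> Du Dv; rewrite hB.1 ?formZl ?[B u _]hB.1//; exact: subspaceZ.
Qed.

Lemma form_sqrZ a u : D u -> B (a *: u) (a *: u) = a ^+ 2 * B u u.
Proof.
by move=> Du; rewrite formZl ?formZr// ?mulrA//; exact: subspaceZ.
Qed.

Lemma form_null_shift a u p : D p -> D u -> (forall v, D v -> B p v = 0) ->
  B (a *: p + u) (a *: p + u) = B u u.
Proof.
move=> Dp Du p0; have Dpu := sD.2 a p u Dp Du.
by rewrite hB.2// p0// mulr0 add0r formZDr// [B u p]hB.1// p0// mulr0 add0r.
Qed.

End form.

Lemma sym_bilinear_comb a b (B C : V -> V -> R) :
  sym_bilinear D B -> sym_bilinear D C ->
  sym_bilinear D (fun u v => a * B u v + b * C u v).
Proof.
move=> [sB lB] [sC lC]; split=> [u v Du Dv|c u v w Du Dv Dw].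
  by rewrite sB// sC.
by rewrite lB// lC//; ring.
Qed.

End forms.

Section bessel.
Context (R : realType) (V : lmodType R) (H L : set V) (ip : V -> V -> R).

(** Bessel's inequality instead of orthonormality: it says that the operator
    [g |-> \sum_(u <- w) ip u g *: u] lies between 0 and 1 (a density matrix),
    and, unlike orthonormality, it survives orthogonal projections. *)
Definition bessel (w : seq V) : Prop :=
  (forall u, u \in w -> H u) /\
  forall g, L g -> \sum_(u <- w) ip u g ^+ 2 <= ip g g.

Definition diag_sum (B : V -> V -> R) (w : seq V) : R := \sum_(u <- w) B u u.

Context (sH : subspace H) (sL : subspace L) (HL : H `<=` L).
Context (hip : sym_bilinear L ip) (ip_ge0 : forall u, L u -> 0 <= ip u u).

Lemma trace_ge0 w : bessel w -> 0 <= diag_sum ip w.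
Proof.
by move=> [wH _]; rewrite /diag_sum big_seq sumr_ge0// => u /wH uH; apply/ip_ge0/HL.
Qed.

Context (E M : V -> V -> R) (K : R).
Context (hE : sym_bilinear H E) (hM : sym_bilinear H M).
Context (E_ge0 : forall u, H u -> 0 <= E u u).
Context (M_le : forall u, H u -> `|M u u| <= K * ip u u).
Context (compact_ip : forall d, 0 < d -> exists2 G : seq V,
  (forall g, g \in G -> L g) & forall u, H u ->
    ip u u <= \sum_(g <- G) ip u g ^+ 2 + d * E u u).
Context (lambda : R).

Definition shifted_form u v := E u v + M u v - lambda * ip u v.
Local Notation Q := shifted_form.

Lemma shifted_form_bilin : sym_bilinear H Q.
Proof.
have hipH : sym_bilinear H ip.
  by split=> [u v /HL ? /HL ?|a u v w /HL ? /HL ? /HL ?]; [apply hip.1|apply hip.2].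
rewrite (_ : Q = fun u v => 1 * (1 * E u v + 1 * M u v) + - lambda * ip u v).
  by apply: sym_bilinear_comb => //; exact: sym_bilinear_comb.
by apply/funext => u; apply/funext => v; rewrite /Q; ring.
Qed.

Let Lam := `|K| + `|lambda|.
Let Lam0 : 0 <= Lam. Proof. by rewrite addr_ge0. Qed.

Lemma shifted_form_ge u : H u -> E u u - Lam * ip u u <= Q u u.
Proof.
move=> Hu; have := M_le Hu; rewrite ler_norml => /andP[+ _].
have i0 := ip_ge0 (HL Hu).
have : K * ip u u <= `|K| * ip u u by rewrite ler_wpM2r// ler_norm.
have : lambda * ip u u <= `|lambda| * ip u u by rewrite ler_wpM2r// ler_norm.
by rewrite /Q /Lam => ? ? ?; lra.
Qed.

Lemma bessel_energy w : bessel w ->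
  diag_sum E w <= diag_sum Q w + Lam * diag_sum ip w.
Proof.
move=> [wH _]; rewrite /diag_sum mulr_sumr -big_split/=.
rewrite big_seq [leRHS]big_seq ler_sum// => u /wH uH.
by have ? := shifted_form_ge uH; lra.
Qed.

(** Bessel's inequality bounds the part of the trace seen by finitely many
    functionals, whatever the length of the family, and compactness bounds the
    rest by the energy.  This is why multiplicities are finite. *)
Lemma bessel_trace_bounded : exists T, 0 <= T /\ forall w, bessel w ->
  diag_sum Q w <= 1 -> diag_sum ip w <= T.
Proof.
pose d := (2 * (Lam + 1))^-1.
have d0 : 0 < d by rewrite invr_gt0 mulr_gt0// ltr_pwDr.
have dL : d * Lam <= 1 / 2.
  have -> : 1 / 2 = d * (Lam + 1) by rewrite /d; field; rewrite gt_eqF// ltr_pwDr.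
  by rewrite ler_pM2l// lerDl.
have d1 : d <= 1 / 2.
  have -> : 1 / 2 = d * (Lam + 1) by rewrite /d; field; rewrite gt_eqF// ltr_pwDr.
  by rewrite ler_peMr ?(ltW d0)// lerDr.
have [G GL GP] := compact_ip d0.
pose N := \sum_(g <- G) ip g g.
have N0 : 0 <= N by rewrite /N big_seq sumr_ge0// => g /GL ?; exact: ip_ge0.
exists (2 * (N + 1)); split=> [|w bw Qw]; first lra.
have tw := trace_ge0 bw; have Ew := bessel_energy bw.
have : diag_sum ip w <= N + d * diag_sum E w.
  apply: (@le_trans _ _ (\sum_(u <- w) (\sum_(g <- G) ip u g ^+ 2 + d * E u u))).
    by rewrite /diag_sum big_seq [leRHS]big_seq ler_sum// => u /bw.1/GP.
  rewrite big_split/= -mulr_sumr lerD2r exchange_big/= /N.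
  by rewrite big_seq [leRHS]big_seq ler_sum// => g /GL /bw.2.
have : d * diag_sum E w <= d * (diag_sum Q w + Lam * diag_sum ip w).
  by rewrite ler_pM2l.
have : d * Lam * diag_sum ip w <= 1 / 2 * diag_sum ip w by rewrite ler_wpM2r.
have : d * diag_sum Q w <= 1 / 2.
  by apply: le_trans d1; rewrite ler_piMr ?(ltW d0).
by move=> ? ? ? ?; lra.
Qed.

Let energies := [set diag_sum Q w | w in bessel].

Let bessel_nil : bessel [::].
Proof. by split=> // g /ip_ge0; rewrite big_nil. Qed.

Let has_inf_energies : has_inf energies.
Proof.
split; first by exists (diag_sum Q [::]), [::].
have [T [T0 TP]] := bessel_trace_bounded; exists (- Lam * T) => _ [w bw <-].
have LT : 0 <= Lam * T by exact: mulr_ge0.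
have [Qw|/ltW Qw] := leP (diag_sum Q w) 1; last first.
  by apply: le_trans Qw; rewrite mulNr; lra.
have E0 : 0 <= diag_sum E w.
  by rewrite /diag_sum big_seq sumr_ge0// => u /bw.1/E_ge0.
have := bessel_energy bw.
have : Lam * diag_sum ip w <= Lam * T by rewrite ler_wpM2l// TP.
by rewrite mulNr => *; lra.
Qed.

Let F := inf energies.

Context (phi psi : V) (Hphi : H phi) (Hpsi : H psi).
Context (phi1 : ip phi phi = 1) (psi1 : ip psi psi = 1) (phipsi : ip phi psi = 0).
Context (phi_eig : forall v, H v -> E phi v + M phi v = lambda * ip phi v).
Context (psi_eig : forall v, H v -> E psi v + M psi v = lambda * ip psi v).

Let P u := - ip u phi *: phi + (- ip u psi *: psi + u).

Let PL u : L u -> L (P u).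
Proof. by move=> Lu; apply: sL.2; [exact: HL|apply: sL.2 => //; exact: HL]. Qed.

Let PH u : H u -> H (P u).
Proof. by move=> Hu; apply: sH.2 => //; apply: sH.2. Qed.

Let ip_P u g : L u -> L g ->
  ip (P u) g = ip u g - ip u phi * ip phi g - ip u psi * ip psi g.
Proof.
move=> Lu Lg; have Lp := HL Hphi; have Lq := HL Hpsi.
by rewrite /P !hip.2//; [ring|exact: sL.2].
Qed.

Let ip_P_sym u g : L u -> L g -> ip (P u) g = ip u (P g).
Proof.
move=> Lu Lg; rewrite [RHS]hip.1 ?ip_P//; last exact: PL.
have Lp := HL Hphi; have Lq := HL Hpsi.
rewrite (hip.1 g u)// (hip.1 g phi)// (hip.1 g psi)// (hip.1 phi u)// (hip.1 psi u)//.
by ring.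
Qed.

Let ip_PP g : L g -> ip (P g) (P g) = ip g g - ip phi g ^+ 2 - ip psi g ^+ 2.
Proof.
move=> Lg; have Lp := HL Hphi; have Lq := HL Hpsi; have LP := PL Lg.
rewrite ip_P// (hip.1 phi _ _ LP)// (hip.1 psi _ _ LP)// (hip.1 g _ _ LP)// !ip_P//.
rewrite phi1 psi1 phipsi (hip.1 psi phi)// phipsi (hip.1 g phi)// (hip.1 g psi)//.
by ring.
Qed.

Let Q_P u : H u -> Q (P u) (P u) = Q u u.
Proof.
move=> Hu; rewrite /P !(form_null_shift sH shifted_form_bilin)//.
- by move=> v Hv; rewrite /Q psi_eig// subrr.
- exact: sH.2.
- by move=> v Hv; rewrite /Q phi_eig// subrr.
Qed.

Let theta x y := x *: phi + y *: psi.

Let Htheta x y : H (theta x y).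
Proof. by apply: sH.2 => //; exact: subspaceZ. Qed.

Let ip_theta x y g : L g -> ip (theta x y) g = x * ip phi g + y * ip psi g.
Proof.
move=> Lg; have Lp := HL Hphi; have Lq := HL Hpsi.
by rewrite /theta hip.2// ?(formZl sL hip)//; exact: subspaceZ.
Qed.

Let theta1 x y : x ^+ 2 + y ^+ 2 = 1 -> ip (theta x y) (theta x y) = 1.
Proof.
have Lp := HL Hphi; have Lq := HL Hpsi => xy; have Lt := HL (Htheta x y).
rewrite ip_theta// (hip.1 phi)// (hip.1 psi)// !ip_theta//.
by rewrite phi1 psi1 phipsi (hip.1 psi phi)// phipsi -[RHS]xy; ring.
Qed.

Let Qtheta x y : Q (theta x y) (theta x y) = 0.
Proof.
have yH : H (y *: psi) by exact: subspaceZ.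
have hQ := shifted_form_bilin; have Hp := subspaceZ.
rewrite /theta (form_null_shift sH hQ)//.
  by rewrite (form_sqrZ sH hQ)// /Q psi_eig// subrr mulr0.
by move=> v Hv; rewrite /Q phi_eig// subrr.
Qed.

(** The last place of the family is partly filled: [beta] is its occupation
    number, by which a projected family can be given a prescribed trace. *)
Definition augment (beta x y : R) (w : seq V) : seq V :=
  Num.sqrt beta *: (x *: phi + y *: psi) :: w.

Let bessel_augment beta x y w : 0 <= beta <= 1 -> x ^+ 2 + y ^+ 2 = 1 ->
  bessel w -> bessel (augment beta x y [seq P u | u <- w]).
Proof.
move=> /andP[b0 b1] xy bw; split.
  move=> u; rewrite inE => /orP[/eqP ->|/mapP[v /bw.1 Hv ->]].
    by apply: subspaceZ => //; exact: Htheta.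
  exact: PH.
move=> g Lg; rewrite /augment big_cons big_map -/(theta x y).
have Lt := HL (Htheta x y).
rewrite (formZl sL hip)// exprMn sqr_sqrtr// ip_theta//.
rewrite big_seq (eq_bigr (fun u => ip u (P g) ^+ 2)); last first.
  by move=> u /bw.1/HL Lu; rewrite ip_P_sym.
rewrite -big_seq.
have := bw.2 _ (PL Lg); rewrite ip_PP//.
set a := ip phi g; set b := ip psi g => ?.
have : beta * (x * a + y * b) ^+ 2 <= a ^+ 2 + b ^+ 2.
  apply: (@le_trans _ _ ((x * a + y * b) ^+ 2)).
    by rewrite ler_piMl// sqr_ge0.
  have -> : a ^+ 2 + b ^+ 2 = (x * a + y * b) ^+ 2 + (y * a - x * b) ^+ 2.
    by rewrite -[LHS]mul1r -xy; ring.
  by rewrite lerDl sqr_ge0.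
by move=> ?; lra.
Qed.

Let trace_augment beta x y w : 0 <= beta -> x ^+ 2 + y ^+ 2 = 1 ->
  diag_sum ip (augment beta x y w) = beta + diag_sum ip w.
Proof.
move=> b0 xy; rewrite /diag_sum big_cons (form_sqrZ sL hip) ?sqr_sqrtr//; last first.
  exact: HL (Htheta x y).
by rewrite theta1// mulr1.
Qed.

Let Q_augment beta x y w :
  diag_sum Q (augment beta x y w) = diag_sum Q w.
Proof.
rewrite /diag_sum big_cons (form_sqrZ sH shifted_form_bilin) ?Qtheta ?mulr0 ?add0r//.
exact: Htheta.
Qed.

Let Q_map_P w : bessel w -> diag_sum Q [seq P u | u <- w] = diag_sum Q w.
Proof.
move=> bw; rewrite /diag_sum big_map big_seq [RHS]big_seq.
by apply: eq_bigr => u /bw.1/Q_P.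
Qed.

Let trace_map_P w : bessel w ->
  0 <= diag_sum ip [seq P u | u <- w] <= diag_sum ip w.
Proof.
move=> bw; rewrite /diag_sum big_map big_seq.
apply/andP; split; last rewrite [leRHS]big_seq.
  by apply: sumr_ge0 => u /bw.1 Hu; exact/ip_ge0/PL/HL.
apply: ler_sum => u /bw.1/HL Lu; rewrite ip_PP//.
by have ? := sqr_ge0 (ip phi u); have ? := sqr_ge0 (ip psi u); lra.
Qed.

(** A near-minimiser of the shifted energy, projected off the eigenvectors, can be
    completed by any unit vector of their span at no cost in shifted energy.
    Occupation numbers in [1 / 2, 1] suffice to round the trace up to a
    half-integer, so that countably many traces are enough; and one trace serves
    for all [eta], obtained from the least half-integer that bounds the traces of
    arbitrarily good near-minimisers. *)
Theorem double_eigenvalue_near_min : exists i : nat,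
  forall eta, 0 < eta -> exists w beta, 1 / 2 <= beta /\
    forall x y, x ^+ 2 + y ^+ 2 = 1 ->
    [/\ bessel (augment beta x y w),
        diag_sum ip (augment beta x y w) = i.+1%:R / 2 &
        forall v, bessel v -> diag_sum ip v = i.+1%:R / 2 ->
          diag_sum E (augment beta x y w) + diag_sum M (augment beta x y w) <=
          diag_sum E v + diag_sum M v + eta].
Proof.
pose near eta w := bessel w /\ diag_sum Q w < F + eta.
have nearP eta : 0 < eta -> exists w, near eta w.
  by move=> e0; have [_ [w bw <-] wF] := inf_adherent e0 has_inf_energies; exists w.
have FQ w : bessel w -> F <= diag_sum Q w.
  by move=> bw; apply: ge_inf; [exact: has_inf_energies.2|exists w].
have F0 : F <= 0 by have := FQ _ bessel_nil; rewrite /diag_sum big_nil.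
pose S (i : nat) := forall eta, 0 < eta -> exists2 w, near eta w &
  diag_sum ip [seq P u | u <- w] <= i%:R / 2.
have exS : exists i, `[< S i >].
  have [T [T0 TP]] := bessel_trace_bounded.
  exists (Num.Def.truncn (2 * T)).+1; apply/asboolP => eta eta0.
  have [|w [bw wF]] := nearP (Num.min eta 1); first by rewrite lt_min eta0 ltr01.
  have m1 : Num.min eta 1 <= eta by rewrite ge_min lexx.
  have m2 : Num.min eta 1 <= 1 by rewrite ge_min lexx orbT.
  exists w; first by split => //; lra.
  have /andP[_ ?] := trace_map_P bw.
  have := TP _ bw ltac:(lra).
  have : 2 * T < (Num.Def.truncn (2 * T)).+1%:R by rewrite truncnS_gt.
  by move=> ? ?; lra.
case: (ex_minnP exS) => i /asboolP Si imin; exists i.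
(* by minimality of [i], good near-minimisers have trace above [(i - 1) / 2] *)
have [eta0 eta00 eta0P] : exists2 eta0, 0 < eta0 & forall w, near eta0 w ->
    (i%:R - 1) / 2 <= diag_sum ip [seq P u | u <- w].
  case: i Si imin => [|j] Sj jmin.
    by exists 1 => // w [bw _]; have /andP[? _] := trace_map_P bw; lra.
  have : ~ S j by move=> Sj'; have := jmin j ltac:(exact/asboolP); rewrite ltnn.
  move=> /existsNP[e0 /not_implyP[e00 ne]]; exists e0 => // w nw.
  rewrite -[j.+1%:R]natr1 addrK leNgt; apply/negP => lt; apply: ne; exists w => //.
  exact: ltW.
move=> eta etapos.
have [|w nw wi] := Si (Num.min eta eta0); first by rewrite lt_min etapos.
have m1 : Num.min eta eta0 <= eta by rewrite ge_min lexx.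
have m2 : Num.min eta eta0 <= eta0 by rewrite ge_min lexx orbT.
have := eta0P w ltac:(split; [exact: nw.1 | have ? := nw.2; lra]).
set t := diag_sum ip [seq P u | u <- w] in wi * => ti.
exists [seq P u | u <- w], (i.+1%:R / 2 - t).
have b12 : 1 / 2 <= i.+1%:R / 2 - t <= 1.
  by rewrite -[i.+1%:R]natr1; apply/andP; split; lra.
have b01 : 0 <= i.+1%:R / 2 - t <= 1 by apply/andP; split; lra.
split; first by lra.
move=> x y xy.
have tr : diag_sum ip (augment (i.+1%:R / 2 - t) x y [seq P u | u <- w]) = i.+1%:R / 2.
  by rewrite trace_augment//; [rewrite subrK|case/andP: b01].
split=> //.
  by apply: bessel_augment => //; exact: nw.1.
move=> v bv tv.
have Qsum z : diag_sum Q z = diag_sum E z + diag_sum M z - lambda * diag_sum ip z.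
  by rewrite /diag_sum mulr_sumr -big_split/= -sumrB.
have := Qsum v; have := Qsum (augment (i.+1%:R / 2 - t) x y [seq P u | u <- w]).
rewrite tr tv Q_augment Q_map_P; last exact: nw.1.
by move=> ? ?; have ? := FQ _ bv; have ? := nw.2; lra.
Qed.

End bessel.

(** * Square-integrable functions *)

Section square_integrable.
Context d (T : measurableType d) (R : realType) (mu : {measure set T -> \bar R}).
Implicit Types u v c : T -> R.

Definition L2 : set (T -> R) := [set u | u \in Lfun mu 2%:E].

Lemma L2_measurable u : L2 u -> measurable_fun setT u.
Proof. by rewrite /L2/= inE => /andP[]; rewrite inE. Qed.

Lemma L2_integrableM u v : L2 u -> L2 v ->
  mu.-integrable setT (fun x => (u x * v x)%:E).
Proof. by move=> Lu Lv; exact/Lfun1_integrable/Lfun2_mul_Lfun1. Qed.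

Lemma L2P u : L2 u <-> measurable_fun setT u /\
  mu.-integrable setT (fun x => (u x ^+ 2)%:E).
Proof.
split=> [Lu|[mu_ iu]].
  split; first exact: L2_measurable.
  exact: Lfun2_integrable_sqr.
rewrite /L2/= inE; apply/andP; rewrite !inE/=; split=> //.
rewrite /finite_norm unlock poweR_lty//=.
move/integrableP : iu => [_]; apply: le_lt_trans.
rewrite ge0_le_integral//; last 1 first.
- by move=> x _; rewrite lee_fin powR_mulrn// normrX.
- apply/measurable_EFinP; apply: (@measurableT_comp _ _ _ _ _ _ (fun x : R => x `^ 2)%R) => //.
  exact/measurableT_comp.
- by apply: measurableT_comp => //; apply/measurable_EFinP; exact: measurable_funX.
Qed.

Lemma L2_subspace : subspace L2.
Proof.
have [L0 LD] := @Lfun_submod_closed _ _ R mu 2%:E (lee1n 2).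
by split=> [|a u v Lu Lv]; [exact: L0|exact: LD].
Qed.

Definition weighted (D : set T) c u v : R := \int[mu]_(x in D) (c x * u x * v x).

Definition inner u v : R := \int[mu]_x (u x * v x).

Lemma innerE u v : inner u v = weighted setT (fun=> 1) u v.
Proof. by apply: eq_Rintegral => x _; rewrite mul1r. Qed.

Section weight.
Context (D : set T) (c : T -> R) (K : R) (mD : measurable D).
Context (mc : measurable_fun setT c) (cK : forall x, D x -> `|c x| <= K).

Lemma weighted_integrable u v : L2 u -> L2 v ->
  mu.-integrable D (fun x => (c x * u x * v x)%:E).
Proof.
move=> Lu Lv; apply: (@le_integrable _ _ _ mu _ mD _ (fun x => (K * (u x * v x))%:E)).
- have muv : measurable_fun setT (fun x => c x * u x * v x).
    by do 2?[apply: measurable_funM => //]; exact: L2_measurable.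
  by apply/measurable_EFinP; exact: measurable_funTS.
- move=> x Dx /=; rewrite lee_fin -mulrA normrM [leRHS]normrM ler_wpM2r//.
  by rewrite (le_trans (cK Dx))// ler_norm.
- have /integrableS : mu.-integrable setT (fun x => (K%:E * (u x * v x)%:E)%E).
    exact/integrableZl/L2_integrableM.
  by apply.
Qed.

Lemma weighted_bilinear : sym_bilinear L2 (weighted D c).
Proof.
split=> [u v _ _|a u v w Lu Lv Lw].
  by apply: eq_Rintegral => x _; rewrite mulrAC.
rewrite -RintegralZl//; last exact: weighted_integrable.
rewrite -RintegralD//.
    apply: eq_Rintegral => x _ /=.
    by rewrite -[(a *: u + v) x]/(a * u x + v x); ring.
  rewrite /comp; under eq_fun do rewrite EFinM.
  by apply: integrableZl => //; exact: weighted_integrable.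
exact: weighted_integrable.
Qed.

Lemma weighted_le u : 0 <= K -> L2 u -> `|weighted D c u u| <= K * inner u u.
Proof.
move=> K0 Lu; apply: (le_trans (le_normr_Rintegral _ (weighted_integrable Lu Lu))) => //.
rewrite -RintegralZl//; last exact: L2_integrableM.
rewrite Rintegral_mkcond; apply: le_Rintegral => //.
- rewrite -restrict_EFin; apply/(integrable_mkcond _ mD).
  exact: (@integrable_norm _ _ _ mu _ _ (weighted_integrable Lu Lu)).
- rewrite /comp; under eq_fun do rewrite EFinM.
  by apply: integrableZl => //; exact: L2_integrableM.
- move=> x _; rewrite patchE; have u2 : 0 <= u x * u x by rewrite -expr2 sqr_ge0.
  case: ifPn => [/set_mem/cK cx|_]; last exact: mulr_ge0.
  by rewrite -mulrA normrM (ger0_norm u2) ler_wpM2r.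
Qed.

End weight.

Lemma inner_bilinear : sym_bilinear L2 inner.
Proof.
rewrite (_ : inner = weighted setT (fun=> 1)); last first.
  by apply/funext => u; apply/funext => v; exact: innerE.
by apply: (@weighted_bilinear _ _ 1) => // x _; rewrite normr1.
Qed.

Lemma inner_ge0 u : 0 <= inner u u.
Proof. by apply: Rintegral_ge0 => x _; rewrite -expr2 sqr_ge0. Qed.

Lemma inner_eq0 u : L2 u -> inner u u = 0 -> u = cst 0 %[ae mu].
Proof.
move=> Lu u0; have iu := L2_integrableM Lu Lu.
have : (\int[mu]_x `|(u x * u x)%:E| = 0)%E.
  rewrite -[RHS]/(0%:E) -u0 /inner /Rintegral fineK; last exact: integrable_fin_num.
  by apply: eq_integral => x _; rewrite gee0_abs// lee_fin -expr2 sqr_ge0.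
move/(ae_eq_integral_abs mu measurableT (measurable_int mu iu)).
apply: filterS => x /= /(_ I) [] /eqP; rewrite mulf_eq0 orbb => /eqP -> //.
Qed.

Lemma ae_eq_inner u u' v v' : measurable_fun setT u -> measurable_fun setT u' ->
  measurable_fun setT v -> measurable_fun setT v' ->
  u = u' %[ae mu] -> v = v' %[ae mu] -> inner u v = inner u' v'.
Proof.
move=> mu1 mu2 mv1 mv2 uu vv; congr fine; apply: ae_eq_integral => //.
- by apply/measurable_EFinP; exact: measurable_funM.
- by apply/measurable_EFinP; exact: measurable_funM.
- by apply: filterS2 uu vv => x /= ux vx _; rewrite ux// vx.
Qed.

End square_integrable.

Section iterated.
Context d1 d2 (T1 : measurableType d1) (T2 : measurableType d2) (R : realType).
Context (m1 : {sigma_finite_measure set T1 -> \bar R}).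
Context (m2 : {sigma_finite_measure set T2 -> \bar R}).
Context (f : T1 * T2 -> R).
Context (fi : (m1 \x m2)%E.-integrable setT (EFin \o f)).

Let G := fubini_G m1 (EFin \o f).

Let aeG : ae_eq m2 setT (fun y => (\int[m1]_x f (x, y))%:E) G.
Proof.
have := ae_integrable2 fi; apply: filterS => y iy _.
by rewrite /Rintegral fineK//; exact: integrable_fin_num.
Qed.

Let mG : measurable_fun setT (fun y => (\int[m1]_x f (x, y))%:E).
Proof.
apply/measurable_EFinP; apply: measurableT_comp => //.
exact: (measurable_fubini_G fi).
Qed.

Lemma Rintegral_iterated :
  \int[m2]_y \int[m1]_x f (x, y) = \int[(m1 \x m2)%E]_z f z.
Proof.
rewrite /Rintegral -(integral21_prod_meas1 fi); congr fine.
by apply: ae_eq_integral => //; exact: (measurable_fubini_G fi).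
Qed.

End iterated.

(** * The fractional energy form *)

Section sobolev_form.
Context (R : realType) (n : nat) (s : R) (Omega : set 'rV[R]_n).
Local Notation Rn := 'rV[R]_n.
Local Notation mu := (lebesgue_rV R n).
Local Notation mu2 := (mu \x mu)%E.
Context (s0 : 0 < s) (mO : measurable Omega) (C0 : 0 <= frac_const n s).
Implicit Types u v : Rn -> R.

(** [Es s u v] is, up to a constant, the L^2 inner product of these quotients on
    the product space, whence its algebraic properties. *)
Definition gagliardo u (z : Rn * Rn) : R :=
  (u z.1 - u z.2) / enorm (z.1 - z.2) `^ (n%:R / 2 + s).

Lemma gagliardo_lin a u v :
  gagliardo (a *: u + v) = a *: gagliardo u + gagliardo v.
Proof.
apply/funext => z; rewrite /gagliardo.
rewrite -[RHS]/(a * gagliardo u z + gagliardo v z) /gagliardo.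
rewrite -[(a *: u + v) z.1]/(a * u z.1 + v z.1) -[(a *: u + v) z.2]/(a * u z.2 + v z.2).
by ring.
Qed.

Lemma gagliardoM u v x y :
  (u x - u y) * (v x - v y) / enorm (x - y) `^ (n%:R + 2 * s) =
  gagliardo u (x, y) * gagliardo v (x, y).
Proof.
rewrite /gagliardo/=; set e := enorm _.
have -> : n%:R + 2 * s = (n%:R / 2 + s) * 2 by field.
by rewrite powRrM powR_mulrn ?powR_ge0// expr2 invfM; ring.
Qed.

Lemma Hs0_L2 u : Hs0 s Omega u -> L2 mu u.
Proof. by case=> -[]. Qed.

Lemma Hs0_gagliardo u : Hs0 s Omega u -> L2 mu2 (gagliardo u).
Proof. by case=> -[]. Qed.

Lemma Hs0_subspace : subspace (Hs0 s Omega).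
Proof.
have [L0 LD] := L2_subspace mu; have [M0 MD] := L2_subspace mu2.
split.
  split; last by apply: nearW => x _.
  split; first exact: L0.
  change (L2 mu2 (gagliardo 0)).
  suff -> : gagliardo 0 = 0 by exact: M0.
  by apply/funext => z; rewrite /gagliardo subrr mul0r.
move=> a u v Hu Hv; split; first split.
- exact: LD (Hs0_L2 Hu) (Hs0_L2 Hv).
- change (L2 mu2 (gagliardo (a *: u + v))); rewrite gagliardo_lin.
  exact: MD (Hs0_gagliardo Hu) (Hs0_gagliardo Hv).
- apply: filterS2 Hu.2 Hv.2 => x u0 v0 Ox.
  by rewrite -[(a *: u + v) x]/(a * u x + v x) u0// v0//= mulr0 addr0.
Qed.

Lemma EsE u v : Hs0 s Omega u -> Hs0 s Omega v ->
  Es s u v = frac_const n s / 2 * inner mu2 (gagliardo u) (gagliardo v).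
Proof.
move=> Hu Hv; rewrite /Es; congr (_ * _).
have iuv := L2_integrableM (Hs0_gagliardo Hu) (Hs0_gagliardo Hv).
rewrite /inner -(Rintegral_iterated iuv).
by apply: eq_Rintegral => y _; apply: eq_Rintegral => x _; rewrite gagliardoM.
Qed.

Lemma Es_bilinear : sym_bilinear (Hs0 s Omega) (Es s).
Proof.
have [sym lin] := inner_bilinear mu2.
split=> [u v Hu Hv|a u v w Hu Hv Hw].
  by rewrite !EsE// sym//; exact: Hs0_gagliardo.
rewrite !EsE//; last exact: Hs0_subspace.2.
by rewrite gagliardo_lin lin; [ring|exact: Hs0_gagliardo..].
Qed.

Lemma Es_ge0 u : Hs0 s Omega u -> 0 <= Es s u u.
Proof. by move=> Hu; rewrite EsE//; apply: mulr_ge0; [exact: divr_ge0|exact: inner_ge0]. Qed.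

Lemma inner_Omega u v : Hs0 s Omega u -> L2 mu v ->
  \int[mu]_(x in Omega) (u x * v x) = inner mu u v.
Proof.
move=> Hu Lv; rewrite Rintegral_mkcond; congr fine.
have iuv := L2_integrableM (Hs0_L2 Hu) Lv.
apply: ae_eq_integral => //.
- apply/measurable_EFinP; apply/(measurable_restrictT _ mO)/measurable_funTS.
  by apply/measurable_EFinP; exact: measurable_int iuv.
- exact: measurable_int iuv.
- apply: filterS Hu.2 => x u0 _; rewrite patchE; case: ifPn => // /negP.
  by rewrite inE => /u0 ->; rewrite mul0r.
Qed.

End sobolev_form.

(** * Lebesgue measure of boxes and product integrals *)

Section box.
Context (R : realType).

Definition box n (B : 'I_n -> set (measurableTypeR R)) : set 'rV[R]_n :=
  [set x | forall i, B i (x ord0 i)].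

Lemma box_measurable n (B : 'I_n -> set (measurableTypeR R)) :
  (forall i, measurable (B i)) -> measurable (box B).
Proof.
move=> mB.
rewrite (_ : box B = \big[setI/setT]_(i < n) (rV_coord i @^-1` B i)).
  apply: bigsetI_measurable => i _; rewrite -[X in measurable X]setTI.
  exact: measurable_rV_coord.
rewrite -bigcap_seq; apply/seteqP; split => x xB i.
  by move=> _; exact: xB.
by apply: (xB i); rewrite /= mem_index_enum.
Qed.

Lemma lebesgue_rV_box n (B : 'I_n -> set (measurableTypeR R)) :
  (forall i, measurable (B i)) ->
  lebesgue_rV R n (box B) = (\prod_(i < n) lebesgue_measure (B i))%E.
Proof.
elim: n B => [|n IH] B mB.
  by rewrite big_ord0 /= diracE mem_set// => -[].
rewrite big_ord_recl /= /lebesgue_rVS /pushforward.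
rewrite (_ : _ @^-1` _ = B ord0 `*` box (fun i => B (lift ord0 i))); last first.
  apply/seteqP; split => -[t x] /=; rewrite /box/=.
    move=> H; split; first by have := H ord0; rewrite rV_cons_head.
    by move=> i; have := H (lift ord0 i); rewrite rV_cons_tail.
  move=> [H0 HS] i; have [j ->|->] := unliftP ord0 i.
    by rewrite rV_cons_tail; exact: HS.
  by rewrite rV_cons_head.
rewrite product_measure1E//; last exact: box_measurable.
by congr (_ * _)%E; rewrite -IH.
Qed.

End box.

Section integral_tools.
Context d (T : measurableType d) (R : realType) (mu : {measure set T -> \bar R}).

Lemma Rintegral_sum (I : Type) (s : seq I) (F : I -> T -> R) :
  (forall i, mu.-integrable setT (fun x => (F i x)%:E)) ->
  mu.-integrable setT (fun x => (\sum_(i <- s) F i x)%:E) /\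
  \int[mu]_x (\sum_(i <- s) F i x) = \sum_(i <- s) \int[mu]_x F i x.
Proof.
move=> iF; elim: s => [|i s [IH1 IH2]]; split.
- by under eq_fun do rewrite big_nil; exact: integrable0.
- rewrite big_nil (@eq_Rintegral _ _ _ _ _ (fun=> 0)); first by rewrite /Rintegral integral0.
  by move=> x _; rewrite big_nil.
- by under eq_fun do rewrite big_cons EFinD; exact: integrableD.
rewrite big_cons -IH2 -RintegralD//; last exact: iF.
by apply: eq_Rintegral => x _; rewrite big_cons.
Qed.

End integral_tools.

Section tensor.
Context d1 d2 (T1 : measurableType d1) (T2 : measurableType d2) (R : realType).
Context (m1 : {sigma_finite_measure set T1 -> \bar R}).
Context (m2 : {sigma_finite_measure set T2 -> \bar R}).
Context (f : T1 -> R) (g : T2 -> R).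
Context (fi : m1.-integrable setT (EFin \o f)) (gi : m2.-integrable setT (EFin \o g)).

Lemma integrable_tensor :
  (m1 \x m2)%E.-integrable setT (fun z => (f z.1 * g z.2)%:E).
Proof.
have mf : measurable_fun setT f by apply/measurable_EFinP; exact: measurable_int fi.
have mg : measurable_fun setT g by apply/measurable_EFinP; exact: measurable_int gi.
apply/integrable12ltyP.
  apply/measurable_EFinP; apply: measurable_funM.
    exact: measurableT_comp.
  exact: measurableT_comp.
rewrite (eq_integral (fun x => (`|f x|%:E * \int[m2]_y `|(g y)%:E|)%E)); last first.
  move=> x _ /=; rewrite -ge0_integralZl//; last first.
    by apply/measurable_EFinP; exact: measurableT_comp.
  by apply: eq_integral => y _; rewrite normrM EFinM.
have /integrableP[_ goo] := gi; have /integrableP[_ foo] := fi.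
rewrite ge0_integralZr//; last exact: integral_ge0.
  rewrite lte_mul_pinfty//; first exact: integral_ge0.
  rewrite ge0_fin_numE//; last exact: integral_ge0.
by apply/measurable_EFinP; exact: measurableT_comp.
Qed.

Lemma Rintegral_tensor :
  \int[(m1 \x m2)%E]_z (f z.1 * g z.2) = (\int[m1]_x f x) * (\int[m2]_y g y).
Proof.
rewrite -(Rintegral_iterated integrable_tensor)/= -RintegralZl//.
by apply: eq_Rintegral => y _; rewrite RintegralZr.
Qed.

End tensor.

(** * Compactness of the form domain *)

Section cells.
Context (R : realType) (n : nat).
Local Notation Rn := 'rV[R]_n.
Local Notation mu := (lebesgue_rV R n).

Definition slab (l : R) (z : int) : set (measurableTypeR R) :=
  [set t | Num.floor ((t : R) / l) = z].

Lemma slabE l z : 0 < l -> slab l z = `[z%:~R * l, (z + 1)%:~R * l[%classic.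
Proof.
move=> l0; apply/seteqP; split => t; rewrite /slab /= in_itv/=.
  by move=> /eqP; rewrite floor_eq ler_pdivlMr// ltr_pdivrMr.
by move=> H; apply/eqP; rewrite floor_eq ler_pdivlMr// ltr_pdivrMr.
Qed.

Lemma slab_measurable l z : 0 < l -> measurable (slab l z).
Proof. by move=> l0; rewrite slabE//; exact: measurable_itv. Qed.

Lemma lebesgue_slab l z : 0 < l -> lebesgue_measure (slab l z) = l%:E.
Proof.
move=> l0; rewrite slabE// lebesgue_measure_itv/= lte_fin ltr_pM2r//.
rewrite ltr_int ltrDl ltr01 -EFinB -mulrBl -intrB.
by rewrite (_ : z + 1 - z = 1) ?mul1r//; ring.
Qed.

(** The offset [N] makes the indices natural numbers, hence of finite type, on a
    bounded region. *)
Definition cell (l : R) (N M : nat) (k : {ffun 'I_n -> 'I_M}) : set Rn :=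
  box (fun i => slab l ((k i : nat)%:Z - N%:Z)).

Context (l : R) (N M : nat) (l0 : 0 < l).
Implicit Types k : {ffun 'I_n -> 'I_M}.

Lemma cell_measurable k : measurable (cell l N k).
Proof. by apply: box_measurable => i; exact: slab_measurable. Qed.

Lemma lebesgue_cell k : mu (cell l N k) = (l ^+ n)%:E.
Proof.
rewrite lebesgue_rV_box; last by move=> i; exact: slab_measurable.
under eq_bigr do rewrite lebesgue_slab//.
by rewrite prodEFin prodr_const card_ord.
Qed.

Lemma cell_inj k k' x : cell l N k x -> cell l N k' x -> k = k'.
Proof.
move=> kx kx'; apply/ffunP => i; apply: val_inj => /=.
have := kx i; rewrite /slab/= (kx' i) => /addIr.
by move=> [].
Qed.

Lemma cell_cover (x : Rn) : (forall i, `|x ord0 i| <= N%:R * l) -> (2 * N < M)%N ->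
  exists k, cell l N k x.
Proof.
move=> xN NM.
have H i : exists j : 'I_M, Num.floor (x ord0 i / l) = (j : nat)%:Z - N%:Z.
  have : `|x ord0 i / l| <= N%:R by rewrite normrM normfV (gtr0_norm l0) ler_pdivrMr.
  rewrite ler_norml => /andP[H1 H2].
  have g0 : 0 <= Num.floor (x ord0 i / l) + N%:Z.
    by rewrite -lerBlDr sub0r floor_ge_int rmorphN.
  have gM : Num.floor (x ord0 i / l) + N%:Z < M%:Z.
    apply: (@le_lt_trans _ _ (2 * N)%N%:Z); last by rewrite ltz_nat.
    rewrite mul2n -addnn PoszD lerD2r -(ler_int R).
    by apply: le_trans H2; exact: floor_le.
  case jE: (Num.floor _ + _) g0 gM => [j|//] _ jM.
  have jM' : (j < M)%N by [].
  by exists (Ordinal jM'); rewrite /= -jE addrK.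
have [k kP] := choice H.
by exists [ffun i => k i] => i; rewrite ffunE; exact: kP.
Qed.

Lemma cell_enorm k x y : cell l N k x -> cell l N k y ->
  enorm (x - y) <= Num.sqrt n%:R * l.
Proof.
move=> kx ky; rewrite /enorm.
have -> : Num.sqrt n%:R * l = Num.sqrt (n%:R * l ^+ 2).
  by rewrite sqrtrM// sqrtr_sqr gtr0_norm.
rewrite ler_wsqrtr// -[n in n%:R]card_ord mulr_natl -sumr_const.
apply: ler_sum => i _; rewrite !mxE -ler_sqrt ?sqr_ge0// !sqrtr_sqr (gtr0_norm l0).
have := kx i; have := ky i; rewrite slabE//= !in_itv/= (intrD _ _ 1) mulrDl mul1r.
by move=> /andP[? ?] /andP[? ?]; rewrite ler_norml; apply/andP; split; lra.
Qed.

End cells.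

Section oscillation.
Context d (T : measurableType d) (R : realType).
Context (mu : {sigma_finite_measure set T -> \bar R}).
Context (A : set T) (mA : measurable A) (V : R) (muA : mu A = V%:E).

Lemma L2_indicM u : L2 mu u -> L2 mu (fun x => \1_A x * u x).
Proof.
move=> /L2P[mu_ iu]; have m : measurable_fun setT (fun x => \1_A x * u x).
  exact: measurable_funM.
apply/L2P; split => //.
apply: (@le_integrable _ _ _ mu _ measurableT _ (fun x => (u x ^+ 2)%:E)) => //.
  by apply/measurable_EFinP; exact: measurable_funX.
move=> x _; rewrite lee_fin !normrX indicE.
by case: (x \in A); rewrite ?mul1r// mul0r normr0 expr0n/= sqr_ge0.
Qed.

Let int_indicA : (\int[mu]_x (\1_A x)%:E)%E = V%:E.
Proof. by rewrite integral_indic// setIT; exact: muA. Qed.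

Lemma integrable_indicA : mu.-integrable setT (EFin \o \1_A).
Proof.
apply/integrableP; split; first exact/measurable_EFinP.
rewrite (eq_integral (fun x => (\1_A x)%:E)); last first.
  by move=> x _ /=; rewrite ger0_norm.
by rewrite int_indicA ltry.
Qed.

Lemma L2_indic : L2 mu (\1_A : T -> R).
Proof.
apply/L2P; split => //.
rewrite (_ : (fun x => _) = EFin \o \1_A); first exact: integrable_indicA.
by apply/funext => x /=; rewrite indicE; case: (x \in A); rewrite ?expr1n// expr0n.
Qed.

(** Expanding the square; this is how the Gagliardo quotient, which involves
    differences only, controls [u] up to its average on [A]. *)
Lemma oscillation u : L2 mu u ->
  (mu \x mu)%E.-integrable setT
    (fun z => (\1_A z.1 * \1_A z.2 * (u z.1 - u z.2) ^+ 2)%:E) /\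
  \int[(mu \x mu)%E]_z (\1_A z.1 * \1_A z.2 * (u z.1 - u z.2) ^+ 2) =
  2 * (V * inner mu (fun x => \1_A x * u x) u - inner mu u \1_A ^+ 2).
Proof.
move=> Lu; have Lau := L2_indicM Lu; have La := L2_indic.
pose f2 x := \1_A x * u x * u x; pose f1 x := u x * \1_A x; pose f0 : T -> R := \1_A.
have i2 : mu.-integrable setT (EFin \o f2) := L2_integrableM Lau Lu.
have i1 : mu.-integrable setT (EFin \o f1) := L2_integrableM Lu La.
have i0 : mu.-integrable setT (EFin \o f0) := integrable_indicA.
have E z : \1_A z.1 * \1_A z.2 * (u z.1 - u z.2) ^+ 2 =
    f2 z.1 * f0 z.2 + f0 z.1 * f2 z.2 - 2 * (f1 z.1 * f1 z.2).
  by rewrite /f2 /f1 /f0; ring.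
have j20 := integrable_tensor i2 i0; have j02 := integrable_tensor i0 i2.
have j11 := integrable_tensor i1 i1.
have k11 : (mu \x mu)%E.-integrable setT (EFin \o (fun z => 2 * (f1 z.1 * f1 z.2))).
  by rewrite /comp; under eq_fun do rewrite EFinM; exact: integrableZl.
have kD : (mu \x mu)%E.-integrable setT
    (EFin \o (fun z => f2 z.1 * f0 z.2 + f0 z.1 * f2 z.2)).
  by rewrite /comp; under eq_fun do rewrite EFinD; exact: integrableD.
under eq_fun do rewrite E; split.
  by under eq_fun do rewrite EFinB; exact: integrableB.
rewrite (eq_Rintegral _ (fun z _ => E z)) RintegralB// RintegralD// RintegralZl//.
rewrite !Rintegral_tensor//.
have -> : \int[mu]_x f0 x = V.
  by rewrite /Rintegral/= int_indicA.
by rewrite /inner -/f2 -/f1 /f2 /f1; ring.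
Qed.

End oscillation.

Section compactness.
Context (R : realType) (n : nat) (s : R) (Omega : set 'rV[R]_n).
Local Notation Rn := 'rV[R]_n.
Local Notation mu := (lebesgue_rV R n).
Local Notation mu2 := (mu \x mu)%E.
Context (s0 : 0 < s) (C0 : 0 < frac_const n s).

Let e := n%:R + 2 * s.

Let e0 : 0 < e. Proof. by rewrite ltr_wpDl// mulr_gt0. Qed.

Lemma enorm_eq0 (x : Rn) : enorm x = 0 -> x = 0.
Proof.
move=> /eqP; rewrite sqrtr_eq0 => x0.
have : \sum_i x ord0 i ^+ 2 == 0 by rewrite eq_le x0 sumr_ge0// => i _; exact: sqr_ge0.
rewrite psumr_eq0; last by move=> i _; exact: sqr_ge0.
move=> /allP H; apply/rowP => i; rewrite mxE; apply/eqP.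
by rewrite -sqrf_eq0; apply: H; rewrite mem_index_enum.
Qed.

Lemma gagliardo_sqr u (x y : Rn) :
  (u x - u y) ^+ 2 = gagliardo s u (x, y) ^+ 2 * enorm (x - y) `^ e.
Proof.
have [xy|xy] := eqVneq (enorm (x - y)) 0.
  have -> : x = y by apply/eqP; rewrite -subr_eq0; apply/eqP/enorm_eq0.
  by rewrite /gagliardo/= !subrr mul0r expr0n mul0r.
rewrite [X in _ = X * _]expr2 -gagliardoM -/e divfK ?expr2// gt_eqF// powR_gt0//.
by rewrite lt0r xy sqrtr_ge0.
Qed.

Let kappa := Num.sqrt n%:R `^ e.

Let chi l N M (k : {ffun 'I_n -> 'I_M}) : Rn -> R := \1_(cell l N k).

Let cell_sum l N M u (z : Rn * Rn) : 0 < l ->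
  \sum_(k : {ffun 'I_n -> 'I_M})
    chi l N k z.1 * chi l N k z.2 * (u z.1 - u z.2) ^+ 2 <=
  kappa * l ^+ n * l `^ (2 * s) * (gagliardo s u z * gagliardo s u z).
Proof.
move=> l0; case: z => x y /=; rewrite -expr2.
have rhs0 : 0 <= kappa * l ^+ n * l `^ (2 * s) * gagliardo s u (x, y) ^+ 2.
  apply: mulr_ge0; last exact: sqr_ge0.
  by rewrite /kappa !mulr_ge0 ?powR_ge0 ?exprn_ge0 ?(ltW l0).
have [[k [kx ky]]|nk] := pselect (exists k : {ffun 'I_n -> 'I_M},
    cell l N k x /\ cell l N k y).
  rewrite (bigD1 k)//= big1 => [|k' k'k]; last first.
    rewrite /chi !indicE (memNset (A := cell l N k')) ?mul0r// => k'x.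
    by move/eqP : k'k; apply; exact: cell_inj k'x kx.
  rewrite addr0 /chi !indicE !mem_set// !mul1r gagliardo_sqr mulrC.
  rewrite ler_wpM2r ?sqr_ge0//.
  have -> : kappa * l ^+ n * l `^ (2 * s) = (Num.sqrt n%:R * l) `^ e.
    rewrite powRM ?sqrtr_ge0 ?(ltW l0)// -mulrA; congr (_ * _).
    by rewrite powRD ?powR_mulrn ?(ltW l0)// (gt_eqF l0) implybT.
  rewrite ge0_ler_powR ?nnegrE ?sqrtr_ge0 ?mulr_ge0 ?sqrtr_ge0 ?(ltW l0) ?(ltW e0)//.
  exact: cell_enorm kx ky.
rewrite big1// => k _; rewrite /chi !indicE.
have [kx|kx] := boolP (x \in _); last by rewrite !mul0r.
have [ky|ky] := boolP (y \in _); last by rewrite mulr0 mul0r.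
by exfalso; apply: nk; exists k; split; exact: set_mem.
Qed.

(** The Rellich embedding in quantitative form: on a grid of cells of side [l],
    the oscillation inside cells costs [O(l^(2s))] times the energy, and the
    cell averages are finitely many functionals. *)
Theorem inner_compact (B : R) : (forall x i, Omega x -> `|x ord0 i| <= B) ->
  forall d, 0 < d -> exists2 G : seq (Rn -> R), (forall g, g \in G -> L2 mu g) &
    forall u, Hs0 s Omega u ->
      inner mu u u <= \sum_(g <- G) inner mu u g ^+ 2 + d * Es s u u.
Proof.
move=> OB d d0; have k0 : 0 < kappa + 1 by rewrite ltr_pwDr// powR_ge0.
(* the side for which the oscillation costs at most [d] times the energy *)
pose l := (d * frac_const n s / (kappa + 1)) `^ (2 * s)^-1.
have a0 : 0 < d * frac_const n s / (kappa + 1) by rewrite divr_gt0// mulr_gt0.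
have l0 : 0 < l by rewrite powR_gt0.
have ls : l `^ (2 * s) = d * frac_const n s / (kappa + 1).
  by rewrite -powRrM mulVf ?powRr1 ?(ltW a0)// gt_eqF// mulr_gt0.
pose N := (Num.Def.truncn (B / l)).+1; pose M := (2 * N).+1.
have NB : B <= N%:R * l by rewrite -ler_pdivrMr// ltW// truncnS_gt.
pose V := l ^+ n; have V0 : 0 < V by rewrite exprn_gt0.
pose c (k : {ffun 'I_n -> 'I_M}) := chi l N k.
have mc k := @cell_measurable _ n l N M l0 k.
have cV k := @lebesgue_cell _ n l N M l0 k.
have Lc k : L2 mu (c k) := L2_indic (mc k) (cV k).
exists [seq (Num.sqrt V)^-1 *: c k | k <- index_enum {ffun 'I_n -> 'I_M}].
  by move=> g /mapP[k _ ->]; exact: subspaceZ (L2_subspace mu) (Lc k).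
move=> u Hu; have Lu := Hs0_L2 Hu; rewrite big_map.
have -> : \sum_k inner mu u ((Num.sqrt V)^-1 *: c k) ^+ 2 =
    V^-1 * \sum_k inner mu u (c k) ^+ 2.
  rewrite mulr_sumr; apply: eq_bigr => k _.
  rewrite (formZr (L2_subspace mu) (inner_bilinear mu))// exprMn exprVn sqr_sqrtr//.
  exact: ltW.
have uu : inner mu u u = \sum_k inner mu (fun x => c k x * u x) u.
  have iuk k : mu.-integrable setT (fun x => (c k x * u x * u x)%:E).
    exact: L2_integrableM (L2_indicM (mc k) Lu) Lu.
  have [iS <-] := Rintegral_sum (index_enum {ffun 'I_n -> 'I_M}) iuk.
  congr fine; apply: ae_eq_integral => //.
  - exact: measurable_int (L2_integrableM Lu Lu).
  - exact: measurable_int iS.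
  apply: filterS Hu.2 => x u0 _.
  have [Ox|Ox] := pselect (Omega x); last first.
    by rewrite u0// mulr0 big1// => k _; rewrite !mulr0.
  have [|k kx] := @cell_cover _ _ l N M l0 x _ (ltnSn _).
    by move=> i; rewrite (le_trans (OB _ i Ox)).
  rewrite (bigD1 k)//= big1 => [|k' k'k].
    by rewrite addr0 /c /chi indicE mem_set// mul1r.
  rewrite /c /chi indicE memNset ?mul0r// => k'x.
  by move/eqP : k'k; apply; exact: cell_inj k'x kx.
pose F k z := c k z.1 * c k z.2 * (u z.1 - u z.2) ^+ 2.
have osc k := oscillation (mc k) (cV k) Lu.
have [iF IF] := Rintegral_sum (index_enum {ffun 'I_n -> 'I_M}) (fun k => (osc k).1).
have igg := L2_integrableM (Hs0_gagliardo Hu) (Hs0_gagliardo Hu).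
have D : \int[mu2]_z (\sum_k F k z) <=
    kappa * V * l `^ (2 * s) * inner mu2 (gagliardo s u) (gagliardo s u).
  rewrite /inner -RintegralZl//.
  apply: le_Rintegral => //.
    by rewrite /comp; under eq_fun do rewrite EFinM; exact: integrableZl.
  by move=> z _; exact: cell_sum.
move: D; rewrite IF.
rewrite (eq_bigr (fun k => 2 * (V * inner mu (fun x => c k x * u x) u -
    inner mu u (c k) ^+ 2))); last by move=> k _; exact: (osc k).2.
rewrite -mulr_sumr sumrB -mulr_sumr -uu.
set S := \sum_k _; set g := inner mu2 _ _ => D.
rewrite (EsE Hu Hu) -/g.
have g0 : 0 <= g by exact: inner_ge0.
have kk : kappa * l `^ (2 * s) <= d * frac_const n s.
  rewrite ls mulrCA ler_piMr//; first by rewrite mulr_ge0// ltW.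
  by rewrite ler_pdivrMr// mul1r lerDl.
have D' : kappa * V * l `^ (2 * s) * g <= V * (d * frac_const n s) * g.
  rewrite ler_wpM2r// [kappa * V]mulrC -mulrA ler_pM2l//.
rewrite -(ler_pM2l V0) mulrDr mulrA divff ?mul1r ?gt_eqF//.
have : V * (d * (frac_const n s / 2 * g)) = V * (d * frac_const n s) * g / 2 by field.
move=> ->; lra.
Qed.

End compactness.

(** * Borel sets and continuous functions on row vectors *)

Section borel.
Context (R : realType) (n : nat).
Local Notation Rn := 'rV[R]_n.

(** Row vectors carry the product sigma-algebra, so this is second countability:
    boxes with rational endpoints form a basis of the topology. *)
Lemma measurable_rV_open (A : set Rn) : open A -> measurable A.
Proof.
move=> oA.
pose Q (q : {ffun 'I_n -> rat * rat}) : set Rn :=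
  box (fun i => `]ratr (q i).1 : R, ratr (q i).2[%classic).
pose F q := if `[< Q q `<=` A >] then Q q else set0.
rewrite (_ : A = \bigcup_q F q).
  apply: countable_bigcupT_measurable => // q.
  rewrite /F; case: ifPn => // _; apply: box_measurable => i.
  exact: measurable_itv.
apply/seteqP; split => x; last first.
  by move=> [q _]; rewrite /F; case: ifPn => // /asboolP; exact.
move=> Ax; have /nbhs_ballP[e /= e0 eA] : nbhs x A by exact: open_nbhs_nbhs.
have qP i : exists q : rat * rat, [/\ x ord0 i - e < ratr q.1 < x ord0 i &
    x ord0 i < ratr q.2 < x ord0 i + e].
  have [|a] := @rat_in_itvoo _ (x ord0 i - e) (x ord0 i); first lra.
  have [|b] := @rat_in_itvoo _ (x ord0 i) (x ord0 i + e); first lra.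
  by rewrite !in_itv => ? ?; exists (a, b).
have [q qx] := choice qP; pose p := [ffun i => q i].
have Qx : Q p x.
  move=> i; rewrite /p ffunE /= in_itv/=.
  by have [/andP[_ ->] /andP[->]] := qx i.
exists p => //; rewrite /F; case: ifPn => // /asboolP[y Qy].
apply: eA; split => // i j; rewrite (ord1 i) /ball/=.
have := Qy j; rewrite /p ffunE /= in_itv/= => /andP[? ?].
have [/andP[? ?] /andP[? ?]] := qx j.
by rewrite ltr_norml; apply/andP; split; lra.
Qed.

Lemma measurable_rV_continuous (f : Rn -> R) :
  continuous f -> measurable_fun setT f.
Proof.
move=> /continuousP cf; apply: (measurability _ (RGenOpens.measurableE R)).
move=> _ [_ [a [b ->] <-]]; rewrite setTI; apply: measurable_rV_open.
exact/cf/interval_open.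
Qed.

Lemma coord_bounded (A : set Rn) : bounded_set A ->
  exists B : R, forall x i, A x -> `|x ord0 i| <= B.
Proof.
move=> /pinfty_ex_gt0[B _ AB]; exists B => x i Ax.
apply: le_trans (AB _ Ax); rewrite [leRHS]/Num.norm/= mx_normrE.
by apply/bigmax_geP; right => /=; exists (ord0, i).
Qed.

Lemma continuous_bounded_on (A : set Rn) (f : Rn -> R) : bounded_set A ->
  continuous f -> exists2 K : R, 0 <= K & forall x, A x -> `|f x| <= K.
Proof.
move=> bA cf.
have [B AB] := coord_bounded bA.
have /(continuous_compact (continuous_subspaceT cf))/compact_bounded :
    compact [set v : Rn | forall i, v ord0 i \in `[- B, B]].
  apply: (@rV_compact _ _ (fun=> `[- B, B]%classic)) => _.
  exact: segment_compact.
move=> /pinfty_ex_gt0[K K0 fK]; exists K; first exact: ltW.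
move=> x Ax; apply: fK; exists x => // i.
by rewrite in_itv/= -ler_norml; exact: AB.
Qed.

End borel.

(** * Positivity of the Gamma function *)

Section gamma.
Context (R : realType).
Local Notation leb := (@lebesgue_measure R).
Implicit Types z t : R.

Let dyad (k : nat) : set R := `]0, (2 ^- k)]%classic.

Let dyad_itv k : leb (dyad k) = (2 ^- k)%:E.
Proof. by rewrite lebesgue_measure_itv/= lte_fin invr_gt0 exprn_gt0// sube0. Qed.

(** Near 0, [t `^ (- q)] with [q < 1] is dominated by the sum over [k] of the
    indicators of [dyad k] weighted by [(2 `^ q) ^+ k.+1], whose integral is a
    geometric series of ratio [2 `^ q / 2]. *)
Let powR_dyad q t : 0 < q -> 0 < t <= 1 -> exists2 k : nat, dyad k t &
  t^-1 `^ q <= 2 `^ q ^+ k.+1.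
Proof.
move=> q0 /andP[t0 t1].
have ex : exists k : nat, t^-1 < 2 ^+ k.+1.
  exists (Num.Def.truncn t^-1).+1; apply: (@lt_trans _ _ (Num.Def.truncn t^-1).+1%:R).
    exact: truncnS_gt.
  rewrite -natrX ltr_nat; apply: (@ltn_trans (2 ^ (Num.Def.truncn t^-1).+1)).
    exact: ltn_expl.
  by rewrite ltn_exp2l.
case: (ex_minnP ex) => k kt kmin; exists k.
  rewrite /dyad /= in_itv/= t0 /=; case: k kt kmin => [|k] kt kmin.
    by rewrite expr0 invr1.
  have : 2 ^+ k.+1 <= t^-1.
    by rewrite leNgt; apply/negP => /kmin; rewrite ltnn.
  by rewrite -(lef_pV2 (x := t^-1)) ?posrE ?exprn_gt0 ?invr_gt0// invrK.
rewrite -powR_mulrn ?powR_ge0// -powRrM mulrC powRrM powR_mulrn//.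
rewrite ge0_ler_powR ?(ltW q0)//; last exact: ltW.
all: by rewrite nnegrE ?invr_ge0 ?exprn_ge0 ?(ltW t0).
Qed.

Let powR01_integrable z : 0 < z ->
  leb.-integrable `]0, 1]%classic (fun t => (t `^ (z - 1))%:E).
Proof.
move=> z0.
have mf : measurable_fun setT (fun t => t `^ (z - 1)) := @measurable_powR R _.
apply/integrableP; split.
  by apply/measurable_EFinP; exact: measurable_funTS.
(* [z] is decreased to at most [1 / 2] to have a negative exponent *)
pose q := 1 - Num.min z (1 / 2).
have [zm zm'] : Num.min z (1 / 2) <= z /\ Num.min z (1 / 2) <= 1 / 2.
  by rewrite !ge_min !lexx orbT.
have zm0 : 0 < Num.min z (1 / 2) by rewrite lt_min z0 divr_gt0.
have q0 : 0 < q by rewrite /q; lra.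
pose a := 2 `^ q; have a0 : 0 < a by rewrite powR_gt0.
pose r := a / 2.
have r1 : r < 1.
  rewrite /r ltr_pdivrMr// mul1r /a -[ltRHS]powRr1//.
  rewrite /powR gt_eqF// ltr_expR ltr_pM2r ?ln_gt0 ?ltr1n// /q; lra.
have r0 : 0 < r by rewrite divr_gt0.
pose g k t : \bar R := (a ^+ k.+1 * \1_(dyad k) t)%:E.
have g0 k t : (0 <= g k t)%E by rewrite lee_fin mulr_ge0// exprn_ge0// ltW.
have mg k : measurable_fun setT (g k).
  apply/measurable_EFinP; apply: measurable_funM => //.
  by apply: measurable_indic; exact: measurable_itv.
apply: (@le_lt_trans _ _ (\int[leb]_(t in `]0%R, 1%R]) (\sum_(k <oo) g k t))%E).
  apply: ge0_le_integral => //.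
  - by apply/measurable_EFinP; apply: measurable_funTS; exact: measurableT_comp.
  - apply: measurable_funTS; apply: ge0_emeasurable_sum => // k _; exact: mg.
  move=> t /=; rewrite in_itv/= => t01.
  have [k kt ka] := powR_dyad q0 t01.
  apply: (@le_trans _ _ (\sum_(0 <= i < k.+1) g i t)%E); last exact: nneseries_lim_ge.
  apply: (@le_trans _ _ (g k t)); last by rewrite big_nat_recr//= leeDr// sume_ge0.
  rewrite /g lee_fin indicE mem_set// mulr1 ger0_norm ?powR_ge0//.
  apply: le_trans ka; case/andP: t01 => t0 t1.
  have -> : z - 1 = (-1) * (1 - z) by ring.
  rewrite powRrM powR_inv1 ?(ltW t0)// ler_powR//.
    by rewrite invf_ge1.
  by rewrite /q lerB.
rewrite integral_nneseries//; last by move=> k; apply: measurable_funTS; exact: mg.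
pose C := a / (1 - r).
apply: (@le_lt_trans _ _ C%:E); last exact: ltry.
apply: lime_le.
  by apply: is_cvg_nneseries => k _ _; exact: integral_ge0.
apply: nearW => N.
have int_g k : (\int[leb]_(t in `]0%R, 1%R]) g k t <= (a * r ^+ k)%:E)%E.
  rewrite (_ : a * r ^+ k = a ^+ k.+1 * 2 ^- k); last first.
    by rewrite /r expr_div_n exprS mulrA.
  rewrite [leLHS](_ : _ = (a ^+ k.+1)%:E * leb (dyad k `&` `]0%R, 1%R]%classic))%E; last first.
    rewrite -integral_indic//; last exact: measurable_itv.
    transitivity (\int[leb]_(t in `]0%R, 1%R]) ((a ^+ k.+1)%:E * (\1_(dyad k) t)%:E))%E.
      by apply: eq_integral => t _; rewrite -EFinM.
    rewrite ge0_integralZl_EFin// ?exprn_ge0 ?(ltW a0)//.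
    apply/measurable_EFinP; apply: measurable_funTS; apply: measurable_indic.
    exact: measurable_itv.
  rewrite EFinM lee_wpmul2l ?lee_fin ?exprn_ge0 ?(ltW a0)// -dyad_itv le_measure ?inE//.
    by apply: measurableI; exact: measurable_itv.
  exact: measurable_itv.
apply: (@le_trans _ _ (\sum_(0 <= k < N) (a * r ^+ k)%:E)%E).
  by apply: lee_sum => k _; exact: int_g.
rewrite sumEFin lee_fin -mulr_sumr /C ler_pM2l// big_mkord.
have := subrX1 r N; rewrite -opprB => H.
rewrite -[leRHS]mul1r ler_pdivlMr ?subr_gt0// mulrC.
have -> : (1 - r) * \sum_(i < N) r ^+ i = 1 - r ^+ N.
  by rewrite -[LHS]opprK -mulNr opprB -subrX1 opprB.
by rewrite gerBl exprn_ge0// ltW.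
Qed.

Let tail_integrable z :
  leb.-integrable `]1, +oo[%classic (fun t => (t `^ (z - 1) * expR (- t))%:E).
Proof.
(* one term of the exponential series absorbs the power, and leaves half of the
   exponential decay *)
pose m := (Num.Def.truncn `|z - 1|).
pose C : R := 2 ^+ m.+1 * (m.+1)`!%:R * 2.
have C0 : 0 < C by rewrite !mulr_gt0 ?exprn_gt0// ltr0n fact_gt0.
have half0 : 0 < (1 / 2 : R) by lra.
apply: (@le_integrable _ _ _ leb _ _ _ (fun t => (C * exponential_pdf (1 / 2) t)%:E)) => //.
- apply/measurable_EFinP; apply: measurable_funTS; apply: measurable_funM.
    exact: measurable_powR.
  by apply: measurableT_comp => //; exact: continuous_measurable_fun.
- move=> t /=; rewrite in_itv/= andbT => t1; have t0 : 0 < t by exact: lt_trans t1.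
  rewrite lee_fin !ger0_norm ?mulr_ge0 ?powR_ge0 ?expR_ge0 ?exponential_pdf_ge0 ?(ltW C0) ?(ltW half0)//.
  rewrite exponential_pdfE ?(ltW t0)//.
  have tp : t `^ (z - 1) <= 2 ^+ m.+1 * (m.+1)`!%:R * expR (t / 2).
    apply: (@le_trans _ _ (t `^ m.+1%:R)).
      rewrite ler_powR ?(ltW t1)//; apply: (le_trans (ler_norm _)).
      by rewrite ltW// truncnS_gt.
    rewrite powR_mulrn ?(ltW t0)//.
    have -> : t ^+ m.+1 = 2 ^+ m.+1 * (m.+1)`!%:R * ((t / 2) ^+ m.+1 / (m.+1)`!%:R).
      by rewrite expr_div_n; field; rewrite expf_neq0//= pnatr_eq0 -lt0n fact_gt0.
    rewrite ler_pM2l ?mulr_gt0 ?exprn_gt0 ?ltr0n ?fact_gt0//.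
    apply: le_trans (expR_ge1Dxn m (_ : 0 <= t / 2)); last by lra.
    by rewrite lerDr.
  have -> : C * (1 / 2 * expR (- (1 / 2) * t)) =
      2 ^+ m.+1 * (m.+1)`!%:R * expR (t / 2) * expR (- t).
    rewrite -[RHS]mulrA -expRD /C (_ : - (1 / 2) * t = t / 2 - t); last by lra.
    by field.
  by rewrite ler_wpM2r ?expR_ge0.
- have /integrableS : leb.-integrable setT (fun t => (C%:E * (exponential_pdf (1 / 2) t)%:E)%E).
    apply: integrableZl => //; exact: (integrable_exponential_pdf (rate := 1/2) half0).
  by apply.
Qed.

Lemma Gamma_gt0 z : 0 < z -> 0 < Gamma z.
Proof.
move=> z0.
pose f t := t `^ (z - 1) * expR (- t).
have mf : measurable_fun setT f.
  apply: measurable_funM; first exact: measurable_powR.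
  by apply: measurableT_comp => //; exact: continuous_measurable_fun.
have i1 : leb.-integrable `]0, 1]%classic (EFin \o f).
  apply: (@le_integrable _ _ _ leb _ _ _ (fun t => (t `^ (z - 1))%:E)) => //.
  - by apply/measurable_EFinP; exact: measurable_funTS.
  - move=> t /=; rewrite in_itv/= => /andP[t0 _].
    rewrite lee_fin normrM ler_piMr// ger0_norm ?expR_ge0//.
    by rewrite -expR0 ler_expR oppr_le0 ltW.
  - exact: powR01_integrable.
have if_ : leb.-integrable `]0, +oo[%classic (EFin \o f).
  rewrite (_ : `]0, +oo[%classic = `]0, 1]%classic `|` `]1, +oo[%classic :> set R).
    apply/integrableP; split; first by apply/measurable_EFinP; exact: measurable_funTS.
    rewrite ge0_integral_setU//.
    - have /integrableP[_ foo1] := i1; have /integrableP[_ foo2] := tail_integrable z.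
      by rewrite lte_add_pinfty.
    - by apply: measurableT_comp => //; apply/measurable_EFinP; exact: measurable_funTS.
    - apply/disj_setPS => t [] /=; rewrite !in_itv/= andbT => /andP[_ t1] t2.
      by have := lt_le_trans t2 t1; rewrite ltxx.
  apply/seteqP; split => t /=; rewrite !in_itv/= !andbT.
    by move=> ->; have [t1|t1] := leP t 1; [left|right].
  by move=> [/andP[]//|]; exact: lt_trans.
have f0 t : 0 <= f t by rewrite mulr_ge0 ?powR_ge0 ?expR_ge0.
rewrite lt_neqAle; apply/andP; split; last first.
  by apply: Rintegral_ge0 => t _; exact: (f0 t).
apply/negP => /eqP G0.
have : (\int[leb]_(t in `]0%R, +oo[) `|(f t)%:E| = 0)%E.
  transitivity (Gamma z)%:E; last by rewrite -G0.
  rewrite /Gamma /Rintegral fineK; last exact: integrable_fin_num.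
  by apply: eq_integral => t _; rewrite gee0_abs// lee_fin.
move/(ae_eq_integral_abs leb (measurable_itv _) (measurable_int leb if_)) => [N [mN N0 DN]].
have : (leb (`]0%R, +oo[%classic : set R) <= leb N)%E.
  apply: le_measure; rewrite ?inE//.
  apply: subset_trans DN => t /=; rewrite in_itv/= andbT => t0 H.
  have [] := H t0; move/eqP; apply/negP.
  by rewrite mulf_neq0 ?gt_eqF ?powR_gt0 ?expR_gt0.
by rewrite N0 lebesgue_measure_itv/= ltry leNgt ltry.
Qed.

Lemma frac_const_gt0 n (s : R) : 0 < s < 1 -> 0 < frac_const n s.
Proof.
move=> /andP[s0 s1]; rewrite /frac_const divr_gt0//.
  by rewrite !mulr_gt0 ?powR_gt0// Gamma_gt0// ltr_wpDr// divr_ge0.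
by rewrite mulr_gt0 ?powR_gt0 ?pi_gt0// Gamma_gt0// subr_gt0.
Qed.

End gamma.

(** * A countable separating family of weights *)

Lemma continuous_mul (R : realType) (X : topologicalType) (f g : X -> R) :
  continuous f -> continuous g -> continuous (fun x => f x * g x).
Proof. by move=> cf cg x; apply: cvgM; [exact: cf|exact: cg]. Qed.

Lemma continuous_add (R : realType) (X : topologicalType) (f g : X -> R) :
  continuous f -> continuous g -> continuous (fun x => f x + g x).
Proof. by move=> cf cg x; apply: cvgD; [exact: cf|exact: cg]. Qed.

Lemma continuous_sub (R : realType) (X : topologicalType) (f g : X -> R) :
  continuous f -> continuous g -> continuous (fun x => f x - g x).
Proof. by move=> cf cg x; apply: cvgB; [exact: cf|exact: cg]. Qed.

Definition ramp (R : realType) (m : nat) (t : R) : R :=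
  Num.max 0 (Num.min 1 (m%:R * t)).

Lemma continuous_ramp (R : realType) (X : topologicalType) m (f : X -> R) :
  continuous f -> continuous (fun x => ramp m (f x)).
Proof.
move=> cf x.
have cmf : continuous (fun x => m%:R * f x).
  by apply: continuous_mul => // y; exact: cvg_cst.
have h1 : {for x, continuous (cst 1 \min (fun x => m%:R * f x))}.
  by apply: (@continuous_min R X (cst 1)); [exact: cst_continuous|exact: cmf].
by apply: (@continuous_max R X (cst 0)) => //; exact: cst_continuous.
Qed.

Section corners.
Context (R : realType) (n : nat).
Local Notation Rn := 'rV[R]_n.
Local Notation mu := (lebesgue_rV R n).

(** A list of constraints rather than one bound for each coordinate: half-spaces
    are then corners, and intersections are concatenations. *)
Definition corner (l : seq ('I_n * rat)) : set Rn :=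
  [set x | forall p, p \in l -> x ord0 p.1 < ratr p.2].

Lemma corner_nil : corner [::] = setT.
Proof. by apply/seteqP; split. Qed.

Lemma corner_cat l l' : corner (l ++ l') = corner l `&` corner l'.
Proof.
apply/seteqP; split => x.
  by move=> H; split => p pl; apply: H; rewrite mem_cat pl ?orbT.
by move=> [H H'] p; rewrite mem_cat => /orP[]; [exact: H|exact: H'].
Qed.

Lemma corner_measurable l : measurable (corner l).
Proof.
elim: l => [|p l IH]; first by rewrite corner_nil.
rewrite -cat1s corner_cat; apply: measurableI => //.
rewrite (_ : corner _ = rV_coord p.1 @^-1` `]-oo, ratr p.2[%classic).
  by rewrite -[X in measurable X]setTI; exact: measurable_rV_coord.
apply/seteqP; split => x; rewrite /corner /= in_itv/=.
  by apply; rewrite inE.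
by move=> H q; rewrite inE => /eqP ->.
Qed.

Lemma measurable_corners : @measurable _ Rn = <<s range corner >>.
Proof.
apply/seteqP; split; last first.
  apply: smallest_sub; first exact: sigma_algebra_measurable.
  by move=> _ [l _ <-]; exact: corner_measurable.
apply: smallest_sub; first exact: smallest_sigma_algebra.
rewrite -bigcup_seq => A [i _] [B mB <-].
pose T' := g_sigma_algebraType (range corner).
suff : measurable_fun (setT : set T') (rV_coord i : T' -> measurableTypeR R).
  by move=> /(_ measurableT _ mB).
apply: (measurability _ (RGenInftyO.measurableE R)).
move=> _ [_ [x ->] <-]; rewrite setTI.
rewrite (_ : _ @^-1` _ = \bigcup_(q : rat)
    (if (ratr q : R) <= x then corner [:: (i, q)] else set0)).
  apply: bigcupT_measurable_rat => q; case: ifPn => // _.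
  by apply: sub_sigma_algebra; exists [:: (i, q)].
apply/seteqP; split => y /=; rewrite in_itv/= /rV_coord.
  move=> /rat_in_itvoo[q]; rewrite in_itv/= => /andP[q1 q2].
  by exists q => //; rewrite (ltW q2) => p; rewrite inE => /eqP ->.
move=> [q _]; case: ifPn => // qx /(_ (i, q)); rewrite inE => /(_ (eqxx _)) /= yq.
exact: lt_le_trans qx.
Qed.

Lemma ramp_itv m (t : R) : 0 <= ramp m t <= 1.
Proof. by rewrite /ramp le_max lexx ge_max ler01 ge_min lexx. Qed.

Definition tent (lm : seq ('I_n * rat) * nat) (x : Rn) : R :=
  \prod_(p <- lm.1) ramp lm.2 (ratr p.2 - x ord0 p.1).

Lemma tent_itv lm x : 0 <= tent lm x <= 1.
Proof.
rewrite /tent; elim/big_rec: _ => [|p t _ /andP[t0 t1]]; first by rewrite ler01 lexx.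
have /andP[r0 r1] := ramp_itv lm.2 (ratr p.2 - x ord0 p.1).
by rewrite mulr_ge0//= mulr_ile1.
Qed.

Lemma tent_continuous lm : continuous (tent lm).
Proof.
case: lm => l m; elim: l => [|p l IH].
  rewrite (_ : tent _ = cst 1); first exact: cst_continuous.
  by apply/funext => x; rewrite /tent big_nil.
rewrite (_ : tent _ = fun x => ramp m (ratr p.2 - x ord0 p.1) * tent (l, m) x).
  apply: continuous_mul; last exact: IH.
  apply: continuous_ramp.
  by apply: continuous_sub; [exact: cst_continuous|exact: coord_continuous].
by apply/funext => x; rewrite /tent big_cons.
Qed.

Lemma tent_cvg l x : exists M, forall m, (M <= m)%N -> tent (l, m) x = \1_(corner l) x.
Proof.
elim: l => [|p l [M IH]].
  by exists 0%N => m _; rewrite /tent big_nil corner_nil indicE in_setT.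
have [xp|xp] := ltP (x ord0 p.1) (ratr p.2); last first.
  exists 0%N => m _; rewrite indicE memNset; last first.
    by move=> /(_ p); rewrite inE eqxx => /(_ isT); rewrite ltNge xp.
  rewrite /tent big_cons /= /ramp (@max_l _ _ 0) ?mul0r// ge_min.
  by rewrite mulr_ge0_le0 ?subr_le0// orbT.
exists (maxn M (Num.Def.truncn (ratr p.2 - x ord0 p.1)^-1).+1) => m.
rewrite geq_max => /andP[Mm pm].
have d0 : 0 < ratr p.2 - x ord0 p.1 by rewrite subr_gt0.
rewrite /tent big_cons /= -/(tent (l, m) x) IH// {1}/ramp min_l; last first.
  rewrite -ler_pdivrMr// mul1r ltW//.
  by apply: (lt_le_trans (truncnS_gt _)); rewrite ler_nat.
rewrite max_r ?ler01// mul1r !indicE -cat1s corner_cat in_setI.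
suff -> : x \in corner [:: p] by [].
by apply/mem_set => q; rewrite inE => /eqP ->.
Qed.

(** The tents converge to the indicators of the corners, a countable pi-system
    that generates the Borel sets. *)
Lemma tent_separating (D : set Rn) (f : Rn -> R) : measurable D ->
  mu.-integrable D (EFin \o f) ->
  (forall lm, \int[mu]_(x in D) (tent lm x * f x) = 0) ->
  ae_eq mu D (EFin \o f) (cst 0%E).
Proof.
move=> mD fi f0; have mf := measurable_int mu fi.
have mt lm : measurable_fun setT (tent lm).
  by apply: measurable_rV_continuous; exact: tent_continuous.
have mtf lm : measurable_fun D (fun x => (tent lm x * f x)%:E).
  apply/measurable_EFinP; apply: measurable_funM; first exact: measurable_funTS.
  exact/measurable_EFinP.
have tf lm : (\int[mu]_(x in D) (tent lm x * f x)%:E = 0)%E.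
  have itf : mu.-integrable D (fun x => (tent lm x * f x)%:E).
    apply: le_integrable fi => // x Dx /=; rewrite lee_fin normrM ler_piMl//.
    by have /andP[t0 t1] := tent_itv lm x; rewrite ger0_norm.
  by rewrite -[LHS]fineK ?integrable_fin_num//; have := f0 lm; rewrite /Rintegral => ->.
have iS A : measurable A -> mu.-integrable (D `&` A) (EFin \o f).
  by move=> mA; apply: (integrableS mD) => //; exact: measurableI.
suff H A : measurable A -> (\int[mu]_(x in D `&` A) (f x)%:E = 0)%E.
  apply: integral_ae_eq => // E ED mE.
  by rewrite integral0 -(setIidr ED) -/(EFin \o f) H.
rewrite measurable_corners; move: A; apply: dynkin_induction.
- exact: measurable_corners.
- move=> _ _ [l _ <-] [l' _ <-]; exists (l ++ l') => //.
  exact: corner_cat.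
- rewrite setIT; have := tf ([::], 0%N).
  by under eq_integral do rewrite /tent big_nil mul1r.
- move=> _ [l _ <-].
  pose g x := (\1_(corner l) x * f x)%:E.
  have mg : measurable_fun D g.
    apply/measurable_EFinP; apply: measurable_funM; last exact/measurable_EFinP.
    by apply: measurable_funTS; apply: measurable_indic; exact: corner_measurable.
  have cvgt : {ae mu, forall x, D x -> (tent (l, m) x * f x)%:E @[m --> \oo] --> g x}.
    apply: nearW => x _; apply: cvg_near_cst; have [M tM] := tent_cvg l x.
    by exists M => // m /= Mm; rewrite /g tM.
  have bnd : {ae mu, forall x m, D x -> (`|(tent (l, m) x * f x)%:E| <= `|(f x)%:E|)%E}.
    apply: nearW => x m _; rewrite lee_fin normrM ler_piMl//.
    by have /andP[t0 t1] := tent_itv (l, m) x; rewrite ger0_norm.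
  have [_ _] := dominated_convergence mD (fun m => mtf (l, m)) mg cvgt (integrable_abse fi) bnd.
  under eq_fun do rewrite tf.
  move=> /(cvg_unique _ (cvg_cst _)) g0; rewrite integral_mkcondr [RHS]g0//.
  apply: eq_integral => x _; rewrite /g patchE indicE.
  by case: (x \in _); rewrite ?mul1r ?mul0r.
- move=> S mS S0; have := tf ([::], 0%N).
  under eq_integral do rewrite /tent big_nil mul1r.
  rewrite -{1}(setIT D) -(setUv S) setIUr integral_setU//.
  + by rewrite S0 add0e.
  + exact: measurableI.
  + by apply: measurableI => //; exact: measurableC.
  + by rewrite -setIUr setUv setIT.
  + by apply/disj_setPS => x [[_ Sx] [_ nSx]].
- move=> F mF tF F0; rewrite setI_bigcupr integral_bigcup//.
  + by rewrite eseries0.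
  + exact: trivIset_setIl.
  + by move=> k; exact: measurableI.
  + by rewrite -setI_bigcupr; apply: iS; exact: bigcupT_measurable.
Qed.

End corners.

(** * Simplicity of the eigenvalues *)

Section no_double_eigenvalue.
Context (R : realType) (n : nat) (s : R) (Omega : set 'rV[R]_n).
Local Notation Rn := 'rV[R]_n.
Local Notation mu := (lebesgue_rV R n).
Local Notation H := (Hs0 s Omega).
Local Notation W := (weighted mu Omega).
Context (hs : 0 < s < 1) (mO : measurable Omega) (bO : bounded_set Omega).
Implicit Types (a b c : Rn -> R) (w : seq (Rn -> R)).

Local Notation bessel0 := (bessel H (L2 mu) (inner mu)).
Local Notation trace := (diag_sum (inner mu)).

Lemma weighted_continuous_bilinear c : continuous c -> sym_bilinear (L2 mu) (W c).
Proof.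
move=> cc; have [K _ cK] := continuous_bounded_on bO cc.
exact: weighted_bilinear mO (measurable_rV_continuous cc) cK.
Qed.

Lemma weighted_weightD c c' t u v : continuous c -> continuous c' ->
  L2 mu u -> L2 mu v ->
  W (fun x => c x + t * c' x) u v = W c u v + t * W c' u v.
Proof.
move=> cc cc' Lu Lv.
have [K _ cK] := continuous_bounded_on bO cc.
have [K' _ cK'] := continuous_bounded_on bO cc'.
have i1 := weighted_integrable mO (measurable_rV_continuous cc) cK Lu Lv.
have i2 := weighted_integrable mO (measurable_rV_continuous cc') cK' Lu Lv.
rewrite /weighted -RintegralZl// -RintegralD//.
  by apply: eq_Rintegral => x _; ring.
by rewrite /comp; under eq_fun do rewrite EFinM; exact: integrableZl.
Qed.

Lemma diag_weightD c c' t w : continuous c -> continuous c' -> bessel0 w ->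
  diag_sum (W (fun x => c x + t * c' x)) w =
  diag_sum (W c) w + t * diag_sum (W c') w.
Proof.
move=> cc cc' bw; rewrite /diag_sum mulr_sumr -big_split/= big_seq [RHS]big_seq.
apply: eq_bigr => u /bw.1 /Hs0_L2 Lu; exact: weighted_weightD.
Qed.

Lemma diag_weight_lip c c' r w : continuous c -> continuous c' -> bessel0 w ->
  (forall x, `|c' x - c x| <= r) ->
  `|diag_sum (W c') w - diag_sum (W c) w| <= trace w * r.
Proof.
move=> cc cc' bw cr.
have r0 : 0 <= r := le_trans (normr_ge0 _) (cr 0).
have cd : continuous (fun x => c' x - c x).
  exact: continuous_sub.
have -> : W c' = W (fun x => c x + 1 * (c' x - c x)).
  by congr (weighted mu Omega _); apply/funext => x; rewrite mul1r addrC subrK.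
rewrite diag_weightD// mul1r [_ + _ - _]addrC addKr.
apply: (le_trans (ler_norm_sum _ _ _)).
rewrite /diag_sum mulr_suml big_seq [leRHS]big_seq; apply: ler_sum => u /bw.1 /Hs0_L2 Lu.
rewrite mulrC; apply: (weighted_le mO (measurable_rV_continuous cd)) => //.
Qed.

Lemma double_eigenfunction_density c lambda (phi psi : Rn -> R) :
  continuous c -> Defs.eigenspace s Omega c lambda phi ->
  Defs.eigenspace s Omega c lambda psi ->
  inner mu phi phi = 1 -> inner mu psi psi = 1 -> inner mu phi psi = 0 ->
  exists i : nat, forall eta, 0 < eta -> exists w beta, 1 / 2 <= beta /\
    forall x y, x ^+ 2 + y ^+ 2 = 1 ->
    [/\ bessel0 (augment phi psi beta x y w),
        trace (augment phi psi beta x y w) = i.+1%:R / 2 &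
        forall v, bessel0 v -> trace v = i.+1%:R / 2 ->
          diag_sum (Es s) (augment phi psi beta x y w) +
          diag_sum (W c) (augment phi psi beta x y w) <=
          diag_sum (Es s) v + diag_sum (W c) v + eta].
Proof.
move=> cc [Hphi ephi] [Hpsi epsi] phi1 psi1 phipsi.
have [/andP[s0 _] C0] := (hs, @frac_const_gt0 R n _ hs).
have [B OB] := coord_bounded bO.
have [K K0 cK] := continuous_bounded_on bO cc.
have HL : H `<=` L2 mu by move=> u; exact: Hs0_L2.
have hW : sym_bilinear H (W c).
  have [sW lW] := weighted_continuous_bilinear cc.
  by split=> [u v /HL ? /HL ?|t u v w /HL ? /HL ? /HL ?]; [exact: sW|exact: lW].
apply: (@double_eigenvalue_near_min _ _ H (L2 mu) (inner mu) _ _ HL _ _ (Es s)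
  (W c) K _ hW _ _ _ lambda phi psi) => //.
- exact: Hs0_subspace.
- exact: L2_subspace.
- exact: inner_bilinear.
- by move=> u _; exact: inner_ge0.
- exact: Es_bilinear.
- by move=> u Hu; apply: Es_ge0 Hu; exact: ltW.
- by move=> u /HL Lu; apply: (weighted_le mO (measurable_rV_continuous cc)).
- exact: inner_compact OB.
- by move=> v Hv; rewrite -(inner_Omega mO Hphi (HL _ Hv)); exact: ephi.
- by move=> v Hv; rewrite -(inner_Omega mO Hpsi (HL _ Hv)); exact: epsi.
Qed.

End no_double_eigenvalue.

Section assembly.
Context (R : realType) (n : nat) (s : R) (Omega : set 'rV[R]_n).
Local Notation Rn := 'rV[R]_n.
Local Notation mu := (lebesgue_rV R n).
Local Notation H := (Hs0 s Omega).
Local Notation W := (weighted mu Omega).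
Local Notation bessel0 := (bessel H (L2 mu) (inner mu)).
Local Notation trace := (diag_sum (inner mu)).
Context (hs : 0 < s < 1) (mO : measurable Omega) (bO : bounded_set Omega).

(** An index [i] for the trace [i.+1 / 2], a tent for the direction, and [m] for
    the error [1 / m.+1]. *)
Definition constraint : Type := nat * (seq ('I_n * rat) * nat) * nat.

Definition constraint_at (k : nat) : constraint :=
  odflt (0, ([::], 0), 0)%N (unpickle k).

Definition fixed_trace (k : nat) : set (seq (Rn -> R)) :=
  [set w | bessel0 w /\ trace w = (constraint_at k).1.1.+1%:R / 2].

Definition test_weight (k : nat) : Rn -> R := tent (constraint_at k).1.2.

Definition energy (a : Rn -> R) (w : seq (Rn -> R)) : R :=
  diag_sum (Es s) w + diag_sum (W a) w.

Definition generic_potential (a b : Rn -> R) : Prop := forall k,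
  pinched (energy a) (fun w b => diag_sum (W b) w) fixed_trace test_weight
    (fun k => (constraint_at k).2.+1%:R^-1) k b.

Lemma exists_generic_potential a eps : 0 < eps -> exists b : Rn -> R,
  [/\ continuous b, forall x, `|b x| <= eps & generic_potential a b].
Proof.
move=> eps0.
apply: (@generic_pinched _ _ _ _ _ _ _ (fun k => (constraint_at k).1.1.+1%:R / 2)) => //.
- by move=> k; exact: tent_continuous.
- by move=> k x; exact: tent_itv.
- by move=> w k b t bc [bw _]; exact: (diag_weightD mO bO t bc (@tent_continuous R n _) bw).
- move=> w k b b' r bc b'c [bw <-] bb'; exact: (diag_weight_lip mO bO bc b'c bw bb').
Qed.

(** Near-minimisers ending with different unit vectors [theta] of the eigenspace
    have nearly equal slopes, so the integral of [h * theta ^+ 2] over [Omega] is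
    the same for all [theta] and all tents [h]. *)
Lemma generic_no_double a b lambda (phi psi : Rn -> R) :
  continuous a -> continuous b -> generic_potential a b ->
  Defs.eigenspace s Omega (fun x => a x + b x) lambda phi ->
  Defs.eigenspace s Omega (fun x => a x + b x) lambda psi ->
  inner mu phi phi = 1 -> inner mu psi psi = 1 -> inner mu phi psi = 0 -> False.
Proof.
move=> ca cb gb ephi epsi phi1 psi1 phipsi.
have cab : continuous (fun x => a x + b x).
  by apply: continuous_add.
have Lphi := Hs0_L2 ephi.1; have Lpsi := Hs0_L2 epsi.1.
have [i iP] := double_eigenfunction_density hs mO bO cab ephi epsi phi1 psi1 phipsi.
have energyD w : bessel0 w -> energy a w + diag_sum (W b) w =
    diag_sum (Es s) w + diag_sum (W (fun x => a x + b x)) w.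
  move=> bw; rewrite /energy -addrA; congr (_ + _).
  have := diag_weightD mO bO 1 ca cb bw; rewrite mul1r => <-.
  by congr (diag_sum (W _) _); apply/funext => x; rewrite mul1r.
pose theta x y : Rn -> R := x *: phi + y *: psi.
have Ltheta x y : L2 mu (theta x y).
  have LL := L2_subspace mu.
  by apply: LL.2 => //; exact: subspaceZ.
have slope lm x y x' y' : x ^+ 2 + y ^+ 2 = 1 -> x' ^+ 2 + y' ^+ 2 = 1 ->
    W (tent lm) (theta x y) (theta x y) <= W (tent lm) (theta x' y') (theta x' y').
  move=> xy xy'; rewrite leNgt; apply/negP => lt.
  (* the error [1 / m.+1] is below [d / 2 <= beta * d] *)
  pose d := W (tent lm) (theta x y) (theta x y) - W (tent lm) (theta x' y') (theta x' y').
  have d0 : 0 < d by rewrite subr_gt0.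
  pose m := Num.Def.truncn (2 / d); pose k := pickle ((i, lm, m) : constraint).
  have kE : constraint_at k = (i, lm, m) by rewrite /constraint_at pickleK.
  have [eta eta0 P] := gb k.
  have [w [beta [beta12 wP]]] := iP _ eta0.
  have bil := weighted_continuous_bilinear mO bO (@tent_continuous R n lm).
  have wE x0 y0 : diag_sum (W (tent lm)) (augment phi psi beta x0 y0 w) =
      beta * W (tent lm) (theta x0 y0) (theta x0 y0) + diag_sum (W (tent lm)) w.
    rewrite /diag_sum big_cons; congr (_ + _).
    rewrite (form_sqrZ (L2_subspace mu) bil); last exact: Ltheta.
    by rewrite sqr_sqrtr//; lra.
  have near x0 y0 : x0 ^+ 2 + y0 ^+ 2 = 1 -> near_min (energy a)
      (fun w b => diag_sum (W b) w) fixed_trace k b eta (augment phi psi beta x0 y0 w).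
    move=> xy0; have [bw tw wmin] := wP _ _ xy0; split.
      by split=> //; rewrite kE.
    by move=> v [bv]; rewrite kE /= => tv; rewrite !energyD//; exact: wmin.
  have := P _ _ (near _ _ xy) (near _ _ xy').
  rewrite /test_weight kE /= !wE opprD addrACA subrr addr0 -mulrBr -/d.
  apply/negP; rewrite -leNgt.
  apply: (@le_trans _ _ (1 / 2 * d)); last by rewrite ler_pM2r.
  rewrite invf_ple ?posrE ?mulr_gt0//.
  have -> : (1 / 2 * d)^-1 = 2 / d by field; rewrite gt_eqF.
  by rewrite ltW// truncnS_gt.
have slopeE lm x y x' y' : x ^+ 2 + y ^+ 2 = 1 -> x' ^+ 2 + y' ^+ 2 = 1 ->
    W (tent lm) (theta x y) (theta x y) = W (tent lm) (theta x' y') (theta x' y').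
  by move=> xy xy'; apply/eqP; rewrite eq_le !slope.
have thetaE x y z : theta x y z = x * phi z + y * psi z by [].
pose f z := phi z * psi z; pose g z := phi z ^+ 2 - psi z ^+ 2.
have iS u v : L2 mu u -> L2 mu v -> mu.-integrable Omega (fun x => (u x * v x)%:E).
  by move=> Lu Lv; apply: (@integrableS _ _ _ _ setT) => //; exact: L2_integrableM.
have itent lm u v : L2 mu u -> L2 mu v ->
    mu.-integrable Omega (fun x => (tent lm x * u x * v x)%:E).
  apply: (weighted_integrable (K := 1) mO (measurable_rV_continuous (@tent_continuous R n lm))).
  by move=> x _; have /andP[? ?] := tent_itv lm x; rewrite ger0_norm.
have f0 : ae_eq mu Omega (EFin \o f) (cst 0%E).
  apply: tent_separating => //; first exact: iS.
  move=> lm.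
  have bil := weighted_continuous_bilinear mO bO (@tent_continuous R n lm).
  (* two unit vectors with rational coordinates that isolate the cross term *)
  have := @slopeE lm (3 / 5) (4 / 5) (3 / 5) (- (4 / 5)) ltac:(field) ltac:(field).
  have LL := L2_subspace mu.
  have L1 := subspaceZ (3 / 5) LL Lphi; have L2' := subspaceZ (4 / 5) LL Lpsi.
  have L3 := subspaceZ (- (4 / 5)) LL Lpsi.
  rewrite /theta !bil.2//; try exact: LL.2.
  rewrite !(formZDr LL bil)//.
  rewrite !(formZl LL bil)// !(formZr LL bil)// ?(bil.1 psi phi)// => E.
  have : W (tent lm) phi psi = 0 by lra.
  by move=> <-; apply: eq_Rintegral => x _; rewrite /f mulrA.
have g0 : ae_eq mu Omega (EFin \o g) (cst 0%E).
  have ig : mu.-integrable Omega (EFin \o g).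
    rewrite (_ : EFin \o g = fun x => ((phi x * phi x)%:E - (psi x * psi x)%:E)%E).
      by apply: integrableB => //; exact: iS.
    by apply/funext => x; rewrite /g /= !expr2 EFinB.
  apply: tent_separating => // lm.
  have := @slopeE lm 1 0 0 1 ltac:(ring) ltac:(ring).
  rewrite (_ : theta 1 0 = phi); last by rewrite /theta scale1r scale0r addr0.
  rewrite (_ : theta 0 1 = psi); last by rewrite /theta scale1r scale0r add0r.
  move=> /eqP; rewrite -subr_eq0 => /eqP E; rewrite -[RHS]E /weighted -RintegralB//.
  - by apply: eq_Rintegral => x _; rewrite /g; ring.
  - exact: itent.
  - exact: itent.
have phi0 : phi = cst 0 %[ae mu].
  apply: filterS3 f0 g0 ephi.1.2 => x fx gx ox _.
  have [Ox|Ox] := pselect (Omega x); last exact: ox.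
  have [{}fx] := fx Ox; have [{}gx] := gx Ox; move: fx gx; rewrite /f /g => fx gx.
  have : (phi x ^+ 2) ^+ 2 = 0.
    have -> : (phi x ^+ 2) ^+ 2 =
        phi x ^+ 2 * (phi x ^+ 2 - psi x ^+ 2) + (phi x * psi x) ^+ 2 by ring.
    by rewrite fx gx mulr0 expr0n add0r.
  by move=> /eqP; rewrite !sqrf_eq0 => /eqP.
have : inner mu phi phi = inner mu (cst 0) (cst 0).
  by apply: ae_eq_inner => //; exact: L2_measurable Lphi.
rewrite phi1 (form0l (L2_subspace mu) (inner_bilinear mu) (L2_subspace mu).1).
by move=> /eqP; rewrite oner_eq0.
Qed.

Lemma eigenspace_subspace c lambda : continuous c ->
  subspace (Defs.eigenspace s Omega c lambda).
Proof.
move=> cc; have sH := Hs0_subspace s Omega.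
have bE := Es_bilinear s Omega.
have bW := weighted_continuous_bilinear mO bO cc.
have bi := inner_bilinear mu.
have LL := L2_subspace mu.
split.
  split; first exact: sH.1.
  move=> v Hv; have Lv := Hs0_L2 Hv; rewrite (inner_Omega mO sH.1 Lv).
  rewrite (form0l sH bE)// (form0l LL bi)// mulr0 add0r.
  exact: (form0l LL bW Lv).
move=> a u v [Hu eu] [Hv ev]; split; first exact: sH.2.
move=> w Hw; have Lw := Hs0_L2 Hw; have Lu := Hs0_L2 Hu; have Lv := Hs0_L2 Hv.
have := eu _ Hw; have := ev _ Hw.
rewrite (inner_Omega mO Hu Lw) (inner_Omega mO Hv Lw).
rewrite (inner_Omega mO (sH.2 a u v Hu Hv) Lw).
rewrite bE.2// bi.2// -![\int[mu]_(x in Omega) _]/(W c _ w).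
rewrite bW.2// => Ev Eu.
have -> : a * Es s u w + Es s v w + (a * W c u w + W c v w) =
   a * (Es s u w + W c u w) + (Es s v w + W c v w) by ring.
by rewrite Ev Eu; ring.
Qed.

(** Otherwise Gram-Schmidt would produce an orthonormal pair of eigenfunctions. *)
Lemma generic_simple a b lambda :
  continuous a -> continuous b -> generic_potential a b ->
  is_eigenvalue s Omega (fun x => a x + b x) lambda ->
  is_simple s Omega (fun x => a x + b x) lambda.
Proof.
move=> ca cb gb [phi [ephi phin0]]; exists phi => // psi epsi.
have cab : continuous (fun x => a x + b x) by exact: continuous_add.
have sE := eigenspace_subspace lambda cab.
have LL := L2_subspace mu; have bi := inner_bilinear mu.
have toL u : Defs.eigenspace s Omega (fun x => a x + b x) lambda u -> L2 mu u.
  by move=> [Hu _]; exact: Hs0_L2 Hu.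
have Lphi := toL _ ephi; have Lpsi := toL _ epsi.
have normal u : Defs.eigenspace s Omega (fun x => a x + b x) lambda u ->
    ~ (u = cst 0 %[ae mu]) -> 0 < inner mu u u.
  move=> eu u0; rewrite lt0r inner_ge0 andbT; apply/eqP => /(inner_eq0 (toL _ eu)).
  exact: u0.
have p0 := normal _ ephi phin0.
pose t := inner mu psi phi / inner mu phi phi.
exists t; apply: contrapT => npsi.
pose chi := (- t) *: phi + psi.
have echi : Defs.eigenspace s Omega (fun x => a x + b x) lambda chi by exact: sE.2.
have Lchi := toL _ echi.
have chiphi : inner mu phi chi = 0.
  rewrite (formZDr LL bi)// (bi.1 phi psi)// /t mulNr divfK ?gt_eqF//.
  by rewrite addrC subrr.
have c0 : 0 < inner mu chi chi.
  apply: normal => // chi0; apply: npsi; apply: filterS chi0 => x chi0 xT.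
  have := chi0 xT; rewrite -[chi x]/(- t * phi x + psi x) /= => E.
  by apply/eqP; rewrite -subr_eq0 -E; apply/eqP; ring.
pose nrm u := (Num.sqrt (inner mu u u))^-1 *: u.
have nrm1 u : L2 mu u -> 0 < inner mu u u -> inner mu (nrm u) (nrm u) = 1.
  move=> Lu u0; rewrite (form_sqrZ LL bi)// exprVn sqr_sqrtr ?(ltW u0)//.
  by rewrite mulVf// gt_eqF.
apply: (generic_no_double ca cb gb (phi := nrm phi) (psi := nrm chi) (lambda := lambda)).
- exact: subspaceZ.
- exact: subspaceZ.
- exact: nrm1.
- exact: nrm1.
- rewrite (formZl LL bi)//; last exact: subspaceZ.
  by rewrite (formZr LL bi)// chiphi !mulr0.
Qed.

End assembly.

Theorem theorem3 (R : realType) (n : nat) (s : R) (Omega : set 'rV[R]_n)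
    (hn : (1 <= n)%N) (hs : 0 < s < 1) (hOmega : bounded_C11_domain Omega) :
  exists2 c0 : R, 0 < c0 &
    forall a : 'rV[R]_n -> R, continuous a ->
    (exists2 m : R, is_min (closure Omega) a m & 0 < m) \/
      (C0norm Omega a <= c0%:E)%E ->
    forall eps : R, 0 < eps ->
    exists b : 'rV[R]_n -> R,
      [/\ continuous b, (C0norm setT b < eps%:E)%E &
          forall lambda : R,
            is_eigenvalue s Omega (fun x => a x + b x) lambda ->
            is_simple s Omega (fun x => a x + b x) lambda].
Proof.
have [oO _ _ bO _] := hOmega; have mO := measurable_rV_open oO.
exists 1 => // a ca _ eps eps0.
have [|b [cb beps gb]] := exists_generic_potential s mO bO a (eps := eps / 2).
  by rewrite divr_gt0.
exists b; split => //; last by move=> lambda; exact: generic_simple.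
apply: (@le_lt_trans _ _ (eps / 2)%:E).
  by apply: ge_ereal_sup => _ [x _ <-]; rewrite lee_fin.
by rewrite lte_fin ltr_pdivrMr// ltr_pMr// ltr1n.
Qed.
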